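(* Let $d\ge1$ and $m\ge1$ be integers, $1\le p<d/m$, and $0<q\le r\le\infty$, with $q\le1$ if $p=1$. Let $p^*:=\frac{dp}{d-mp}$ and let $\Omega\subseteq\mathbb{R}^d$ be a nonempty open subset. Then there is a $c>0$ such that $$b_n\big(W_0^mL^{p,q}(\Omega)\hookrightarrow L^{p^*,r}(\Omega)\big)\ge c\cdot n^{\frac1r-\frac1q}\qquad\text{for all integers } n\ge1.$$ Moreover, when $q=r$ the embedding $W_0^mL^{p,q}(\Omega)\hookrightarrow L^{p^*,r}(\Omega)$ is not strictly singular.
   Context: Conventions: $\frac1\infty=0$. All function spaces on $\Omega$ use Lebesgue measure. Lorentz spaces: for a measure space $(\Omega,\mu)$, $0<p<\infty$ and $0<r\le\infty$, $L^{p,r}(\mu)$ is the set of measurable functions $f$ with $\|f\|_{L^{p,r}(\mu)}=\big(\int_0^\infty t^{\frac rp-1}f^*(t)^r\,dt\big)^{1/r}<\infty$, where $f^*(t)=\inf\{\alpha>0:\mu\{x:|f(x)|>\alpha\}\le t\}$ is the decreasing rearrangement; for $r=\infty$ the quasi-norm is $\sup_{t>0}t^{1/p}f^*(t)$. Sobolev-Lorentz spaces: for $\Omega\subseteq\mathbb{R}^d$ open, an integer $m\ge0$, and either $1<p<\infty$, $0<r\le\infty$, or $p=1\ge r>0$, $W^mL^{p,r}(\Omega)$ is the space of locally integrable functions $f$ on $\Omega$ with $\|f\|_{W^mL^{p,r}(\Omega)}:=\sum_{|\alpha|\le m}\|\partial^\alpha f\|_{L^{p,r}(\Omega)}<\infty$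 (distributional derivatives). $W_0^mL^{p,r}(\Omega)$ is the closure of $C_c^\infty(\Omega)$ under this quasi-norm. Bernstein numbers: for a bounded linear map $T:X\to Y$ between quasi-Banach spaces, $b_n(T):=\sup\{\inf_{x\in X_n,\ \|x\|_X=1}\|Tx\|_Y : X_n\subseteq X \text{ an } n\text{-dimensional subspace}\}$. Strict singularity: $T:X\to Y$ is strictly singular if there is no infinite-dimensional subspace $Z\subseteq X$ such that $T|_Z$ is an isomorphism from $Z$ onto $T(Z)$; equivalently, $\inf_{x\in Z,\ \|x\|_X=1}\|Tx\|_Y=0$ for every infinite-dimensional subspace $Z\subseteq X$. *)

(* Defs.v *)
From HB Require Import structures.
From mathcomp Require Import all_boot all_order all_algebra.
From mathcomp Require Import all_classical all_reals all_analysis.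

Set Implicit Arguments.
Unset Strict Implicit.
Unset Printing Implicit Defensive.

Import Order.TTheory GRing.Theory Num.Theory.
Import numFieldNormedType.Exports.

Local Open Scope classical_set_scope.
Local Open Scope ring_scope.

Fact measure_rV_display : measure_display.
Proof. exact: default_measure_display. Qed.

Section measurable_rV.
Context {R : realType} (d : nat).

Let coors : 'I_d -> 'rV[R]_d -> R := fun i x => x ord0 i.

Let rV_set0 : g_sigma_preimage coors set0.
Proof. exact: sigma_algebra0. Qed.

Let rV_setC A : g_sigma_preimage coors A -> g_sigma_preimage coors (~` A).
Proof. exact: sigma_algebraC. Qed.

Let rV_bigcup (F : _^nat) : (forall i, g_sigma_preimage coors (F i)) ->
  g_sigma_preimage coors (\bigcup_i (F i)).
Proof. exact: sigma_algebra_bigcup. Qed.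

(* The sigma-algebra generated by the coordinates; on R^d it is the Borel
   sigma-algebra. *)
HB.instance Definition _ := @isMeasurable.Build measure_rV_display
  'rV[R]_d (g_sigma_preimage coors) rV_set0 rV_setC rV_bigcup.

End measurable_rV.

Section lebesgue_rV.
Context {R : realType}.

Definition rV_cons d (xy : R * 'rV[R]_d) : 'rV[R]_d.+1 :=
  \row_i (if unlift ord0 i is Some j then xy.2 ord0 j else xy.1).

Definition rV_uncons d (x : 'rV[R]_d.+1) : R * 'rV[R]_d :=
  (x ord0 ord0, \row_j x ord0 (lift ord0 j)).

Lemma rV_consK d : cancel (@rV_cons d) (@rV_uncons d).
Proof.
case=> x y; rewrite /rV_uncons /rV_cons; congr pair.
  by rewrite mxE unlift_none.
by apply/rowP => j; rewrite !mxE liftK.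
Qed.

Lemma rV_unconsK d : cancel (@rV_uncons d) (@rV_cons d).
Proof.
move=> x; apply/rowP => i; rewrite mxE.
by case: unliftP => [j|] -> //=; rewrite mxE.
Qed.

Lemma measurable_coord d (i : 'I_d) :
  measurable_fun [set: 'rV[R]_d] (fun x => x ord0 i).
Proof.
move=> _ Y mY; rewrite setTI; apply: sub_sigma_algebra => /=.
rewrite -bigcup_seq/=; exists i => /=; first by rewrite mem_index_enum.
by exists Y => //; rewrite setTI.
Qed.

Lemma measurable_fun_rVP d d1 (T1 : measurableType d1) (f : T1 -> 'rV[R]_d) :
  (forall i, measurable_fun [set: T1] (fun x => f x ord0 i)) ->
  measurable_fun [set: T1] f.
Proof.
move=> mf; apply: (@measurability _ _ _ _ _ _
  (\big[setU/set0]_(i < d) preimage_set_system setT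
     (fun x : 'rV[R]_d => x ord0 i) measurable)) => //.
move=> _ [A + <-].
rewrite -bigcup_seq/= => -[i _ [B mB <-]].
by have := mf i measurableT B mB; rewrite !setTI.
Qed.

Lemma measurable_rV_cons d : measurable_fun setT (@rV_cons d).
Proof.
apply: measurable_fun_rVP => i; rewrite /rV_cons.
under eq_fun do rewrite mxE.
case: unliftP => [j|] _; last exact: measurable_fst.
exact: (measurableT_comp (measurable_coord j) measurable_snd).
Qed.

Lemma measurable_rV_uncons d : measurable_fun setT (@rV_uncons d).
Proof.
apply/measurable_fun_pair; first exact: measurable_coord.
apply: measurable_fun_rVP => j; under eq_fun do rewrite mxE.
exact: measurable_coord.
Qed.

Section lebesgue_rV_cons.
Variables (d : nat) (m : {sigma_finite_measure set 'rV[R]_d -> \bar R}).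

Definition lebesgue_rV_cons : set 'rV[R]_d.+1 -> \bar R :=
  pushforward (@lebesgue_measure R \x m)%E (@rV_cons d).

Let measurable_rV_cons_preimage (A : set 'rV[R]_d.+1) :
  measurable A -> measurable (@rV_cons d @^-1` A).
Proof. by move=> mA; rewrite -[X in measurable X]setTI; exact: measurable_rV_cons. Qed.

Let lebesgue_rV_cons0 : lebesgue_rV_cons set0 = 0%E.
Proof. by rewrite /lebesgue_rV_cons /pushforward preimage_set0 measure0. Qed.

Let lebesgue_rV_cons_ge0 A : (0 <= lebesgue_rV_cons A)%E.
Proof. by rewrite /lebesgue_rV_cons /pushforward measure_ge0. Qed.

Let lebesgue_rV_cons_sigma_additive : semi_sigma_additive lebesgue_rV_cons.
Proof.
move=> F mF tF mUF; rewrite /lebesgue_rV_cons /pushforward preimage_bigcup.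
apply: measure_semi_sigma_additive.
- by move=> n; exact: measurable_rV_cons_preimage.
- apply/trivIsetP => /= i j _ _ ij; rewrite -preimage_setI.
  by move/trivIsetP : tF => /(_ _ _ _ _ ij) ->//; rewrite preimage_set0.
- by rewrite -preimage_bigcup; exact: measurable_rV_cons_preimage.
Qed.

HB.instance Definition _ := isMeasure.Build _ _ _ lebesgue_rV_cons
  lebesgue_rV_cons0 lebesgue_rV_cons_ge0 lebesgue_rV_cons_sigma_additive.

Let lebesgue_rV_cons_sigma_finite : sigma_finite setT lebesgue_rV_cons.
Proof.
have /sigma_finiteP[F [FT ndF Foo]] := sigma_finiteT (@lebesgue_measure R).
have /sigma_finiteP[G [GT ndG Goo]] := sigma_finiteT m.
exists (fun n => @rV_uncons d @^-1` (F n `*` G n)).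
  rewrite -preimage_bigcup (_ : \bigcup_n (F n `*` G n) = setT) ?preimage_setT//.
  apply/seteqP; split => // -[x y] _.
  have [i _ Fx] : (\bigcup_i F i) x by rewrite -FT.
  have [j _ Gy] : (\bigcup_i G i) y by rewrite -GT.
  exists (maxn i j) => //; split => /=.
    by move: x Fx; exact/subsetPset/ndF/leq_maxl.
  by move: y Gy; exact/subsetPset/ndG/leq_maxr.
move=> n; have [mF Fn] := Foo n; have [mG Gn] := Goo n; split.
  rewrite -[X in measurable X]setTI; apply: measurable_rV_uncons => //.
  exact: measurableX.
rewrite /lebesgue_rV_cons /pushforward -comp_preimage.
rewrite (_ : @rV_uncons d \o @rV_cons d = id); last first.
  by apply/funext => x /=; rewrite rV_consK.
by rewrite product_measure1E// lte_mul_pinfty// ge0_fin_numE.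
Qed.

HB.instance Definition _ := Measure_isSigmaFinite.Build _ _ _ lebesgue_rV_cons
  lebesgue_rV_cons_sigma_finite.

End lebesgue_rV_cons.

(* d-dimensional Lebesgue measure on the Borel sets, as the iterated product of
   the one-dimensional one. *)
Fixpoint lebesgue_rV d : {sigma_finite_measure set 'rV[R]_d -> \bar R} :=
  if d is d'.+1 then lebesgue_rV_cons (lebesgue_rV d') else \d_(0 : 'rV[R]_0).

End lebesgue_rV.

Section lorentz.
Context {dp : measure_display} {T : measurableType dp} {R : realType}.
Variable mu : set T -> \bar R.
Implicit Types (D : set T) (f : T -> R).

(* [D] is the underlying measure space (with the restriction of [mu]); values of
   [f] outside [D] play no role.  The infimum of the empty set is +oo. *)
Definition rearrangement D f (t : R) : \bar R :=
  ereal_inf [set a%:E | a in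
    [set a : R | 0 < a /\ (mu (D `&` [set x | (a < `|f x|)%R]) <= t%:E)%E]].

(* Used for 0 < p and 0 < r <= +oo only; the last branch is a filler. *)
Definition lorentz_norm D (p : R) (r : \bar R) f : \bar R :=
  match r with
  | r'%:E =>
      ((\int[@lebesgue_measure R]_(t in `]0%R, +oo[)
          ((t `^ (r' / p - 1))%R%:E * rearrangement D f t `^ r')) `^ r'^-1%R)%E
  | +oo%E =>
      ereal_sup [set ((t `^ p^-1)%R%:E * rearrangement D f t)%E
                | t in [set t : R | 0 < t]]
  | -oo%E => 0%E
  end.

End lorentz.

Section sobolev.
Context {R : realType} {d : nat}.
Implicit Types (Omega : set 'rV[R]_d) (f g phi : 'rV[R]_d -> R).

Definition partial (i : 'I_d) f : 'rV[R]_d -> R := 'D_(delta_mx ord0 i) f.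

Definition partials (s : seq 'I_d) f : 'rV[R]_d -> R := foldr partial f s.

(* A function is C^oo iff all its iterated partial derivatives, in any order,
   exist everywhere and are continuous. *)
Definition smooth f : Prop := forall s : seq 'I_d,
  continuous (partials s f) /\
  forall i x, derivable (partials s f) x (delta_mx ord0 i).

(* C_c^oo(Omega), each function being extended by 0 to the whole space. *)
Definition test_function Omega phi : Prop :=
  [/\ smooth phi, compact (closure [set x | phi x != 0]) &
      closure [set x | phi x != 0] `<=` Omega].

Definition multi_partial (alpha : 'I_d -> nat) f : 'rV[R]_d -> R :=
  partials (flatten [seq nseq (alpha i) i | i <- enum 'I_d]) f.

Definition locally_integrable_rV Omega f : Prop :=
  measurable_fun Omega f /\
  forall K, K `<=` Omega -> compact K ->
    (\int[lebesgue_rV d]_(x in K) `|f x|%:E < +oo)%E.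

Definition weak_derivative Omega (alpha : 'I_d -> nat) f g : Prop :=
  [/\ locally_integrable_rV Omega f, locally_integrable_rV Omega g &
  forall phi, test_function Omega phi ->
    \int[lebesgue_rV d]_(x in Omega) (f x * multi_partial alpha phi x) =
    (-1) ^+ (\sum_i alpha i)%N *
      \int[lebesgue_rV d]_(x in Omega) (g x * phi x)].

(* The distributional derivative of order alpha is unique up to null sets, so
   the infimum below is over versions of one function; it is +oo when that
   derivative is not a locally integrable function. *)
Definition sobolev_lorentz_norm (m : nat) (p : R) (r : \bar R) Omega f : \bar R :=
  (\sum_(alpha : {ffun 'I_d -> 'I_m.+1} | (\sum_i alpha i <= m)%N)
    ereal_inf [set lorentz_norm (lebesgue_rV d) Omega p r g
              | g in weak_derivative Omega (fun i => alpha i) f])%E.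

End sobolev.

(* Only the data of a quasi-normed space, realised by representatives in an
   ambient vector space [V]: vectors are identified when the quasi-norm of
   their difference is 0, as for functions equal almost everywhere. *)
Record qnormed_space (R : realType) (V : lmodType R) := QNormedSpace {
  qn_carrier : set V ;
  qnorm : V -> \bar R }.

Section operators.
Context {R : realType} {V W : lmodType R}.
Implicit Types (X : qnormed_space V) (Y : qnormed_space W) (T : V -> W).

Definition lincomb n (e : 'I_n -> V) (a : 'I_n -> R) : V :=
  \sum_i a i *: e i.

Definition independent X n (e : 'I_n -> V) : Prop :=
  forall a, qnorm X (lincomb e a) = 0%E -> forall i, a i = 0.

Definition subspace_of_dim X (n : nat) : set (set V) :=
  [set Z | exists e : 'I_n -> V,
    [/\ forall i, qn_carrier X (e i), independent X e & Z = range (lincomb e)]].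

Definition unit_sphere X (Z : set V) : set V :=
  [set x | Z x /\ qnorm X x = 1%E].

(* The condition on [T @` Z] is void when [T] maps [X] into [Y]; it makes sure
   that [qnorm Y] is only evaluated on elements of [Y]. *)
Definition bernstein_number X Y T (n : nat) : \bar R :=
  ereal_sup [set ereal_inf [set qnorm Y (T x) | x in unit_sphere X Z]
            | Z in [set Z | subspace_of_dim X n Z /\ T @` Z `<=` qn_carrier Y]].

(* [Z] is not required to be closed. *)
Definition infinite_dim_subspace X (Z : set V) : Prop :=
  [/\ Z `<=` qn_carrier X, Z 0,
      forall (a : R) x y, Z x -> Z y -> Z (a *: x + y) &
      forall n, exists e : 'I_n -> V, (forall i, Z (e i)) /\ independent X e].

(* For the linear map [T], being an isomorphism of quasi-normed spaces from [Z]
   onto [T @` Z] amounts to being bounded with a bounded inverse. *)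
Definition isomorphism_onto_image X Y T (Z : set V) : Prop :=
  T @` Z `<=` qn_carrier Y /\
  exists c C : R, [/\ 0 < c, 0 < C & forall z, Z z ->
    (c%:E * qnorm X z <= qnorm Y (T z) <= C%:E * qnorm X z)%E].

Definition strictly_singular X Y T : Prop :=
  ~ exists Z, infinite_dim_subspace X Z /\ isomorphism_onto_image X Y T Z.

End operators.

Section spaces.
Context {R : realType} {d : nat}.
Implicit Types (Omega : set 'rV[R]_d) (f phi : 'rV[R]_d -> R).

Definition lorentz_space (p : R) (r : \bar R) Omega :
    qnormed_space ('rV[R]_d -> R) :=
  let N := lorentz_norm (lebesgue_rV d) Omega p r in
  QNormedSpace [set f | measurable_fun Omega f /\ (N f < +oo)%E] N.

Definition sobolev_lorentz_space (m : nat) (p : R) (r : \bar R) Omega :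
    qnormed_space ('rV[R]_d -> R) :=
  let N := sobolev_lorentz_norm m p r Omega in
  QNormedSpace [set f | locally_integrable_rV Omega f /\ (N f < +oo)%E] N.

(* The closure of C_c^oo(Omega) in the Sobolev-Lorentz space. *)
Definition sobolev_lorentz_space0 (m : nat) (p : R) (r : \bar R) Omega :
    qnormed_space ('rV[R]_d -> R) :=
  let W := sobolev_lorentz_space m p r Omega in
  QNormedSpace
    [set f | qn_carrier W f /\ forall eps : R, 0 < eps ->
       exists2 phi, test_function Omega phi & (qnorm W (f - phi) < eps%:E)%E]
    (qnorm W).

End spaces.

(* Main.v *)
(* With t_j = rho / 2^(j+1) and a bump Phi supported in the cube ]1, 2[^d, the
   functions phi_j(x) = t_j^(m - d/p) Phi((x - y) / t_j) have disjoint supports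
   in Omega.  Their L^(p star) norms and the L^p norms of their derivatives of
   order m do not depend on j, and the lower order derivatives are smaller.
   Since the supports shrink geometrically, the Lorentz quasi-norm of a sum of
   a_j phi_j, or of one of its derivatives, with second exponent s is comparable
   to (at most, below the top order) the l^s quasi-norm of a.  On the span of n
   of the phi_j the embedding thus behaves like the identity from l^q to l^r,
   bounded below by n^(1/r - 1/q), and for q = r it is an isomorphism on the span
   of all of them.  The lower bound on the Sobolev-Lorentz norm rests on the
   uniqueness of weak derivatives. *)
Require Import Defs.
From mathcomp Require Import all_boot all_order all_algebra.
From mathcomp Require Import all_classical all_reals all_analysis.
From mathcomp Require Import measurable_realfun ring lra.

Set Implicit Arguments.
Unset Strict Implicit.
Unset Printing Implicit Defensive.

Import Order.TTheory GRing.Theory Num.Theory.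
Import numFieldNormedType.Exports.
Local Open Scope classical_set_scope.
Local Open Scope ring_scope.

(** * Boxes and Borel sets *)

(** The triangle inequality of a quasi-norm holds only up to a factor, and iterating it over [n]
    summands would lose uniformity in [n]. Both Lorentz estimates therefore look at level sets of
    the whole sum, whose j-th piece has height about |a_j| s_j^(-d/p) on a set of measure about
    s_j^d. From above, all supports lie in cubes with the common corner [y]; such cubes are nested,
    so a single one contains a whole superlevel set. From below, the fixed ratio of the s_j makes
    each interval ]s_(j+1)^d, s_j^d[ as long as s_j^d up to a constant. The Sobolev quasi-norm is an
    infimum over versions of the weak derivatives. One version, the classical derivative, gives an
    upper bound, but a lower bound must hold for all of them; uniqueness almost everywhere on one
    box containing all the supports is enough for this. *)

Definition obox {R : realType} {d} (a b : 'I_d -> R) : set 'rV[R]_d :=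
  [set x | forall i, a i < x ord0 i < b i].

Lemma obox_consE {R : realType} d (a b : 'I_d.+1 -> R) :
  @rV_cons R d @^-1` obox a b =
  `]a ord0, b ord0[%classic `*` obox (a \o lift ord0) (b \o lift ord0).
Proof.
apply/seteqP; split => -[x y] /=.
  move=> h; split.
    by have := h ord0; rewrite /rV_cons mxE unlift_none in_itv.
  by move=> i; have := h (lift ord0 i); rewrite /rV_cons mxE liftK.
move=> [xab yab] i; rewrite /rV_cons mxE.
by case: unliftP => [j ->|->]; [exact: yab|move: xab; rewrite in_itv].
Qed.

Lemma measurable_obox {R : realType} d (a b : 'I_d -> R) : measurable (obox a b).
Proof.
rewrite (_ : obox a b = \bigcap_(i in [set: 'I_d])
   ((fun x : 'rV[R]_d => x ord0 i) @^-1` `]a i, b i[%classic)).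
  apply: fin_bigcap_measurable => // i _; rewrite -[X in measurable X]setTI.
  by apply: measurable_coord => //; exact: measurable_itv.
apply/seteqP; split => x /=.
  by move=> h i _ /=; rewrite in_itv; exact: h.
by move=> h i; have := h i I; rewrite /= in_itv.
Qed.

Lemma lebesgue_obox {R : realType} d (a b : 'I_d -> R) :
  (forall i, a i <= b i) ->
  lebesgue_rV d (obox a b) = (\prod_i (b i - a i))%:E.
Proof.
elim: d a b => [|d ih] a b ab.
  rewrite /= big_ord0 diracE mem_set//.
  by case.
rewrite /= /lebesgue_rV_cons /pushforward obox_consE.
rewrite product_measure1E//; last exact: measurable_obox.
rewrite ih; last by move=> i; exact: ab.
rewrite [X in (X * _)%E](lebesgue_measure_itv `]a ord0, b ord0[)/= lte_fin.
rewrite big_ord_recl EFinM.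
move: (ab ord0); rewrite le_eqVlt => /predU1P[->|->]//.
by rewrite ltxx subrr !mul0e.
Qed.

(** The sigma-algebra is generated by the coordinates, so an open set has to be written as a
    countable union of boxes: those with rational corners that it contains. *)
Lemma open_measurable_rV {R : realType} d (U : set 'rV[R]_d) :
  open U -> measurable U.
Proof.
move=> oU.
pose B (ab : {ffun 'I_d -> rat} * {ffun 'I_d -> rat}) : set 'rV[R]_d :=
  obox (fun i => ratr (ab.1 i)) (fun i => ratr (ab.2 i)).
rewrite (_ : U = \bigcup_ab [set x | B ab x /\ B ab `<=` U]).
  apply: countable_bigcupT_measurable => // ab.
  have [BU|BU] := EM (B ab `<=` U).
    rewrite (_ : [set x | _] = B ab); first exact: measurable_obox.
    by apply/seteqP; split => [x []|x Bx].
  rewrite (_ : [set x | _] = set0)//.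
  by apply/seteqP; split => // x [].
apply/seteqP; split => x; last by case=> ab _ [Bx]; apply.
move=> Ux; have : nbhs x U by exact: open_nbhs_nbhs.
move=> /nbhs_ballP[e /= e0 xeU].
have /choice[a ha] : forall i : 'I_d, exists q : rat,
    ratr q \in `](x ord0 i - e), (x ord0 i)[.
  by move=> i; apply: rat_in_itvoo; rewrite ltrBlDr ltrDl.
have /choice[b hb] : forall i : 'I_d, exists q : rat,
    ratr q \in `](x ord0 i), (x ord0 i + e)[.
  by move=> i; apply: rat_in_itvoo; rewrite ltrDl.
exists ([ffun i => a i], [ffun i => b i]) => //; split.
  move=> i /=; rewrite !ffunE.
  by have := ha i; have := hb i; rewrite !in_itv/= => /andP[-> _] /andP[_ ->].
move=> y; rewrite /B/= => yB; apply: xeU; split => // i j.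
rewrite ord1 -[0]/(ord0); have := yB j; rewrite !ffunE.
have := ha j; have := hb j; rewrite !in_itv/= /ball/=.
move=> /andP[h1 h2] /andP[h3 h4] /andP[h5 h6].
by rewrite ltr_norml; apply/andP; split; [lra|lra].
Qed.

Lemma closed_measurable_rV {R : realType} d (A : set 'rV[R]_d) :
  closed A -> measurable A.
Proof.
move=> cA; rewrite -[A]setCK; apply: measurableC.
by apply: open_measurable_rV; rewrite openC.
Qed.

Lemma continuous_measurable_rV {R : realType} d (f : 'rV[R]_d -> R) :
  continuous f -> measurable_fun setT f.
Proof.
move=> cf; apply: (measurability _ (RGenOpens.measurableE R)).
move=> _ [_ [a [b ->] <-]]; rewrite setTI; apply: open_measurable_rV.
by move/continuousP : cf; apply; exact: interval_open.
Qed.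

(** * Smooth bumps on the line *)

(* flat 1 is exp(- 1 / t) for t > 0; the family is closed under differentiation,
   whence the smoothness of all its members. *)
Definition flat {R : realType} (P : {poly R}) (t : R) : R :=
  if 0 < t then P.[t^-1] * expR (- t^-1) else 0.

(** The extra power [u ^+ k] carries the induction on [P]: the leading part of [P * 'X + c] hands
    its factor [u] over to that power. *)
Lemma poly_expRN_bounded {R : realType} (P : {poly R}) k :
  exists2 C : R, 0 <= C & forall u, 0 < u -> `|P.[u]| * u ^+ k * expR (- u) <= C.
Proof.
elim/poly_ind: P k => [|P c ih] k.
  by exists 0 => // u _; rewrite horner0 normr0 !mul0r.
have [C C0 hC] := ih k.+1.
exists (C + `|c| * k.+1`!%:R * expR 1).
  by rewrite addr_ge0// mulr_ge0// ?mulr_ge0// expR_ge0.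
move=> u u0; rewrite hornerD hornerM hornerX hornerC.
have step1 : `|P.[u] * u + c| * u ^+ k * expR (- u) <=
    `|P.[u]| * u ^+ k.+1 * expR (- u) + `|c| * (u ^+ k * expR (- u)).
  have -> : `|P.[u]| * u ^+ k.+1 * expR (- u) + `|c| * (u ^+ k * expR (- u)) =
    (`|P.[u] * u| + `|c|) * u ^+ k * expR (- u).
    by rewrite normrM (gtr0_norm u0) exprS; ring.
  rewrite ler_wpM2r ?expR_ge0// ler_wpM2r ?ler_normD//.
  by rewrite exprn_ge0// ltW.
apply: (le_trans step1); apply: lerD; first exact: hC.
rewrite -mulrA ler_wpM2l//.
(* The exponential series is used at [u + 1] because [u ^+ k <= (u + 1) ^+ k.+1] also holds for
   small [u]; the shift costs the factor [expR 1]. *)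
have h1 : (u + 1) ^+ k.+1 <= k.+1`!%:R * expR (u + 1).
  have := expR_ge1Dxn k (ltW (addr_gt0 u0 ltr01)).
  move=> /(le_trans _) h; rewrite mulrC -ler_pdivrMr ?ltr0n ?fact_gt0//.
  by apply: h; rewrite lerDr.
have h2 : u ^+ k <= (u + 1) ^+ k.+1.
  rewrite exprS -[leLHS]mul1r ler_pM ?exprn_ge0 ?(ltW u0)//.
    by rewrite lerDr ltW.
  by rewrite lerXn2r ?nnegrE ?lerDl// ltW// addr_gt0.
apply: (@le_trans _ _ (k.+1`!%:R * expR (u + 1) * expR (- u))).
  by rewrite ler_wpM2r ?expR_ge0// (le_trans h2).
by rewrite -mulrA -expRD addrAC subrr add0r.
Qed.

(** In the variable u = 1/t, differentiation in t is - u^2 d/du, which turns P(u) exp(-u) into u^2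
    (P - P')(u) exp(-u). At 0 the previous bound with [k = 2] gives |flat P h| <= C h^2, so the
    difference quotient tends to 0. *)
Lemma is_derive_flat {R : realType} (P : {poly R}) (t : R) :
  is_derive t 1 (flat P) (flat ('X^2 * (P - P^`())) t).
Proof.
have [t0|t0|->] := ltrgt0P t.
- apply: (@near_eq_is_derive R R R (fun s => P.[s^-1] * expR (- s^-1))).
    near=> s; rewrite /flat ifT//.
    by near: s; exact: lt_nbhsr.
  have tn0 : t != 0 by rewrite gt_eqF.
  have dV : is_derive t 1 (fun s : R => s^-1) (- t ^- 2).
    by have := @is_deriveV _ id t 1 1 tn0 (is_derive_id _ _);
      rewrite /GRing.scale/= mulr1.
  have dP := @is_derive1_comp _ (horner P) (fun s : R => s^-1) t _ _
    (is_derive_poly P _) dV.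
  have dE := @is_derive1_comp _ expR (fun s : R => - s^-1) t _ _
    (is_derive_expR _) (is_deriveN dV).
  apply: (trigger_derive (is_deriveM dP dE)); rewrite [LHS](_ : _ =
    P.[t^-1] * (expR (- t^-1) * - - t ^- 2) +
    expR (- t^-1) * (P^`().[t^-1] * - t ^- 2)); last by [].
  rewrite /flat t0 hornerM hornerXn hornerD hornerN exprVn; ring.
- rewrite [X in is_derive _ _ _ X](_ : _ = 0); last by rewrite /flat ltNge ltW.
  apply: (@near_eq_is_derive R R R (cst 0)).
  near=> s; rewrite /flat ifF//; apply/negbTE; rewrite -leNgt; apply/ltW.
  by near: s; exact: lt_nbhsl.
- rewrite {2}/flat ltxx.
  have [C C0 hC] := poly_expRN_bounded P 2.
  have bnd h : `|flat P h| <= C * h ^+ 2.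
    rewrite /flat; case: ifPn => h0; last by rewrite normr0 mulr_ge0// sqr_ge0.
    rewrite normrM (gtr0_norm (expR_gt0 _)).
    rewrite -ler_pdivrMr ?exprn_gt0// mulrAC -exprVn; apply: hC.
    by rewrite invr_gt0.
  have cv : h^-1 *: (flat P (h *: (1:R) + 0) - flat P 0) @[h --> 0^'] --> (0 : R).
    apply/cvgr0Pnorm_le => e e0; near=> h.
    have hn0 : h != 0 by near: h; exact: nbhs_dnbhs_neq.
    rewrite addr0 [flat P 0]/flat ltxx subr0 /GRing.scale/= mulr1 normrM normfV.
    rewrite ler_pdivrMl ?normr_gt0// (le_trans (bnd h))//.
    rewrite -(real_normK (num_real h)) expr2 mulrCA ler_wpM2l//.
    have : `|h| <= e / (C + 1).
      by near: h; apply: dnbhs0_le; rewrite divr_gt0// ltr_wpDl.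
    rewrite ler_pdivlMr ?ltr_wpDl// mulrDr mulr1 [C * _]mulrC.
    by apply: le_trans; rewrite lerDl.
  split; first by apply/cvg_ex; exists 0.
  exact: cvg_lim cv.
Unshelve. all: by end_near. Qed.

Definition smooth1 {R : realType} (f : R -> R) : Prop :=
  forall n x, derivable (derive1n n f) x 1.

Lemma smooth1_is_derive {R : realType} (f : R -> R) n (x : R) :
  smooth1 f -> is_derive x 1 (derive1n n f) (derive1n n.+1 f x).
Proof.
by move=> sf; rewrite derive1nS derive1E; exact/derivableP/sf.
Qed.

Lemma smooth1_continuous {R : realType} (f : R -> R) n :
  smooth1 f -> continuous (derive1n n f).
Proof.
move=> sf x; apply: differentiable_continuous.
exact/derivable1_diffP/sf.
Qed.

Lemma smooth1_flat {R : realType} (P : {poly R}) : smooth1 (flat P).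
Proof.
suff H n : exists Q : {poly R}, (derive1n n (flat P)) = flat Q.
  by move=> n x; have [Q ->] := H n; exact: (@ex_derive _ _ _ _ _ _ _ (is_derive_flat Q x)).
elim: n => [|n [Q IH]]; first by exists P.
exists ('X^2 * (Q - Q^`())); rewrite derive1nS IH; apply/funext => x.
rewrite derive1E; exact: (@derive_val _ _ _ _ _ _ _ (is_derive_flat Q x)).
Qed.

(** Leibniz' formula is avoided: (f g)' = f g' + g f' is a sum of two products to which the
    induction hypothesis applies with one order less. Only orders up to [n] are assumed, since [g']
    and [f'] have lost one. *)
Lemma derive1nM_derivable {R : realType} n (f g : R -> R) :
  (forall k x, (k <= n)%N -> derivable (derive1n k f) x 1) ->
  (forall k x, (k <= n)%N -> derivable (derive1n k g) x 1) ->
  forall k x, (k <= n)%N -> derivable (derive1n k (f \* g)) x 1.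
Proof.
have sumC (u v : R -> R) N :
    (forall k x, (k <= N)%N -> derivable (derive1n k u) x 1) ->
    (forall k x, (k <= N)%N -> derivable (derive1n k v) x 1) ->
    forall k, (k <= N)%N -> (derive1n k (u \+ v)) = (derive1n k u) \+ (derive1n k v) /\
      forall x, derivable (derive1n k (u \+ v)) x 1.
  move=> du dv; elim=> [|k ih] kN.
    by split=> // x; apply: derivableD; [exact: (du 0%N)|exact: (dv 0%N)].
  have [E _] := ih (ltnW kN).
  have E' : (derive1n k.+1 (u \+ v)) = (derive1n k.+1 u) \+ (derive1n k.+1 v).
    rewrite !derive1nS E; apply/funext => x /=; rewrite !derive1E deriveD//.
      by apply: du; exact: ltnW.
    by apply: dv; exact: ltnW.
  by split=> // x; rewrite E'; apply: derivableD; [exact: du|exact: dv].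
elim: n f g => [|n ih] f g df dg k x.
  rewrite leqn0 => /eqP ->.
  by apply: derivableM; [exact: (df 0%N)|exact: (dg 0%N)].
have E : (derive1 (f \* g)) = (f \* (derive1 g)) \+ (g \* (derive1 f)).
  apply/funext => y /=; rewrite !derive1E deriveM//.
    exact: (df 0%N).
  exact: (dg 0%N).
case: k => [_|k kn].
  by apply: derivableM; [exact: (df 0%N)|exact: (dg 0%N)].
rewrite derive1Sn E.
apply: (sumC _ _ n _ _ k _).2 => // {kn x k}.
  apply: ih => k x kn; first by apply: df; exact: leqW.
  by rewrite -derive1Sn; exact: dg.
apply: ih => k x kn; first by apply: dg; exact: leqW.
by rewrite -derive1Sn; exact: df.
Qed.

Lemma smooth1M {R : realType} (f g : R -> R) :
  smooth1 f -> smooth1 g -> smooth1 (f \* g).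
Proof.
by move=> sf sg n x; apply: (@derive1nM_derivable _ n).
Qed.

Lemma is_derive_affine {R : realType} (c b x : R) :
  is_derive x (1 : R) (fun y : R => c * y + b) c.
Proof.
have : is_derive x (1 : R) (fun y : R => c * y + b) (c *: (1 : R) + 0).
  exact: (is_deriveD (is_deriveZ c (is_derive_id x (1 : R))) (is_derive_cst b x (1 : R))).
by rewrite /GRing.scale/= mulr1 addr0.
Qed.

Lemma derive1n_affine {R : realType} (f : R -> R) (c b : R) n : smooth1 f ->
  (derive1n n (fun x => f (c * x + b))) = (fun x => c ^+ n * (derive1n n f) (c * x + b)).
Proof.
move=> sf; elim: n => [|n ih].
  by apply/funext => x; rewrite /= mul1r.
rewrite derive1nS ih; apply/funext => x; rewrite derive1E.
have da := is_derive_affine c b x.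
have dc := is_deriveZ (c ^+ n)
  (@is_derive1_comp _ (derive1n n f) (fun y => c * y + b) x _ _
    (smooth1_is_derive n (c * x + b) sf) da).
apply: etrans (@derive_val _ _ _ _ _ _ _ dc) _.
by rewrite /GRing.scale/= exprSr; ring.
Qed.

Lemma smooth1_affine {R : realType} (f : R -> R) (c b : R) : smooth1 f ->
  smooth1 (fun x => f (c * x + b)).
Proof.
move=> sf n x; rewrite derive1n_affine//.
have da := is_derive_affine c b x.
have dc := is_deriveZ (c ^+ n)
  (@is_derive1_comp _ (derive1n n f) (fun y => c * y + b) x _ _
    (smooth1_is_derive n (c * x + b) sf) da).
exact: (@ex_derive _ _ _ _ _ _ _ dc).
Qed.

Lemma derive1n_eq0_open {R : realType} (f : R -> R) (U : set R) n :
  open U -> (forall x, U x -> f x = 0) -> forall x, U x -> derive1n n f x = 0.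
Proof.
move=> oU f0; elim: n => [//|n ih] x Ux.
rewrite derive1nS derive1E -(derive_cst (0 : R) x (1 : R)).
apply: (@near_eq_derive R R R).
near=> y; apply: ih; near: y; exact: open_nbhs_nbhs.
Unshelve. all: by end_near. Qed.

(* With k = 1 a bump on ]a, b[; as k grows it tends to the indicator of ]a, b[. *)
Definition bump {R : realType} (a b k x : R) : R :=
  flat 1 (k * (x - a)) * flat 1 (k * (b - x)).

Section bump.
Context {R : realType}.
Implicit Types a b k x : R.

Lemma flat1E x : flat 1 x = if 0 < x then expR (- x^-1) else 0.
Proof. by rewrite /flat; case: ifP => // _; rewrite hornerE mul1r. Qed.

Lemma flat1_ge0 x : 0 <= flat 1 x.
Proof. by rewrite flat1E; case: ifP => // _; exact: expR_ge0. Qed.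

Lemma flat1_le1 x : flat 1 x <= 1.
Proof.
rewrite flat1E; case: ifP => // x0.
by rewrite -expR0 ler_expR oppr_le0 invr_ge0 ltW.
Qed.

Lemma smooth1_bump a b k : smooth1 (bump a b k).
Proof.
apply: smooth1M.
  rewrite (_ : (fun x => _) = fun x => flat 1 (k * x + - (k * a))).
    by apply: smooth1_affine; exact: smooth1_flat.
  by apply/funext => x; rewrite mulrBr.
rewrite (_ : (fun x => _) = fun x => flat 1 (- k * x + k * b)).
  by apply: smooth1_affine; exact: smooth1_flat.
by apply/funext => x; rewrite mulrBr addrC mulNr.
Qed.

Lemma bump_ge0 a b k x : 0 <= bump a b k x.
Proof. by rewrite mulr_ge0 ?flat1_ge0. Qed.

Lemma bump_le1 a b k x : bump a b k x <= 1.
Proof. by rewrite -[leRHS]mulr1 ler_pM ?flat1_ge0 ?flat1_le1. Qed.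

Lemma bump_gt0 a b k x : 0 < k -> a < x < b -> 0 < bump a b k x.
Proof.
move=> k0 /andP[ax xb]; rewrite /bump !flat1E.
by rewrite !ifT ?mulr_gt0 ?subr_gt0// expR_gt0.
Qed.

Lemma bump_eq0 a b k x : 0 < k -> ~~ (a < x < b) -> bump a b k x = 0.
Proof.
rewrite negb_and -!leNgt => k0 /orP[xa|bx]; rewrite /bump !flat1E.
  by rewrite ifF ?mul0r// ltNge pmulr_rle0// subr_le0 xa.
by rewrite [X in _ * X]ifF ?mulr0// ltNge pmulr_rle0// subr_le0 bx.
Qed.

Lemma bump_cvg1 a b x : a < x < b -> bump a b n.+1%:R x @[n --> \oo] --> (1 : R).
Proof.
move=> /andP[ax xb].
have F c : 0 < c -> flat 1 (n.+1%:R * c) @[n --> \oo] --> (1 : R).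
  move=> c0; rewrite (_ : (fun n => _) = fun n => expR (- (n.+1%:R^-1 * c^-1))).
    rewrite -[X in _ --> X](_ : expR (- (0 * c^-1)) = 1); last first.
      by rewrite mul0r oppr0 expR0.
    apply: continuous_cvg; first exact: continuous_expR.
    apply: cvgN; apply: cvgMl; exact: cvg_harmonic.
  by apply/funext => n; rewrite flat1E mulr_gt0// invfM.
rewrite -[X in _ --> X]mul1r; apply: cvgM; apply: F; by rewrite subr_gt0.
Qed.

Lemma derive1n_bump_eq0 a b k n x : 0 < k -> ~~ (a <= x <= b) ->
  derive1n n (bump a b k) x = 0.
Proof.
move=> k0 nx; apply: (@derive1n_eq0_open _ _ (~` `[a, b]%classic)).
- by rewrite openC; exact: itv_closed.
- move=> y; rewrite /= in_itv/= => /negP; rewrite negb_and -!ltNge => yab.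
  apply: bump_eq0 => //; rewrite negb_and -!leNgt.
  by case/orP: yab => /ltW ->; rewrite ?orbT.
- by rewrite /= in_itv/=; exact/negP.
Qed.

Lemma derive1n_bump_bounded a b k n : 0 < k ->
  exists2 M, 0 < M & forall x, `|derive1n n (bump a b k) x| <= M.
Proof.
move=> k0.
have /compact_bounded[M [_ hM]] : compact (derive1n n (bump a b k) @` `[a, b]%classic).
  apply: continuous_compact; last exact: segment_compact.
  by apply: continuous_subspaceT; apply: smooth1_continuous; exact: smooth1_bump.
exists (`|M| + 1) => [|x]; first by rewrite ltr_wpDl.
have [xab|xab] := boolP (a <= x <= b).
  apply: hM; first by rewrite (le_lt_trans (ler_norm M))// ltrDl.
  by exists x => //=; rewrite in_itv.
by rewrite derive1n_bump_eq0// normr0 addr_ge0.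
Qed.

(** If the derivative of order [n.+1] vanished everywhere, the one of order [n] would be constant,
    equal to its value 0 to the left of [a]. *)
Lemma derive1n_bump_neq0 a b k n : 0 < k -> a < b ->
  exists x, derive1n n (bump a b k) x != 0.
Proof.
move=> k0 ab; elim: n => [|n [y hy]].
  exists ((a + b) / 2); rewrite /= gt_eqF// bump_gt0//.
  by rewrite !midf_lt.
apply/not_existsP => H.
have H0 x : derive1n n.+1 (bump a b k) x = 0.
  by apply/eqP/negPn/negP; exact: H.
move/negP : hy; apply; apply/eqP.
rewrite -(@derive1n_bump_eq0 a b k n (a - 1))//; last first.
  by rewrite negb_and -!ltNge ltrBlDr ltrDl ltr01.
apply: is_derive_0_is_cst => x; rewrite -(H0 x).
exact/smooth1_is_derive/smooth1_bump.
Qed.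

(** A nonzero value persists on an interval by continuity. In this quantitative form it yields level
    sets of positive measure in [comb_lower]. *)
Lemma derive1n_bump_lb a b k n : 0 < k -> a < b ->
  exists delta u v, [/\ 0 < delta, u < v &
    forall x, u < x < v -> delta < `|derive1n n (bump a b k) x|].
Proof.
move=> k0 ab; have [x0 x0n] := derive1n_bump_neq0 n k0 ab.
set g := derive1n n (bump a b k) in x0n *.
have cg : {for x0, continuous (fun x => `|g x|)}.
  apply: (@continuous_comp _ _ _ g Num.norm); last exact: norm_continuous.
  by apply: smooth1_continuous; exact: smooth1_bump.
have g0 : 0 < `|g x0| / 2 by rewrite divr_gt0 ?normr_gt0.
have : \forall x \near x0, `|g x0| / 2 < `|g x|.
  apply: (cvgr_gt _ cg); by rewrite ltr_pdivrMr// ltr_pMr ?normr_gt0 ?ltr1n.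
move=> /nbhs_ballP[e /= e0 he].
exists (`|g x0| / 2), (x0 - e), (x0 + e); split => //.
  by rewrite ltrBlDr -addrA ltrDl addr_gt0.
move=> x /andP[h1 h2]; apply: he; rewrite /ball/= ltr_norml.
by apply/andP; split; lra.
Qed.

End bump.

(** * Integration by parts *)

Lemma integrable_bounded_support {d} {T : measurableType d} {R : realType}
    (mu : {measure set T -> \bar R}) (A : set T) (C : R) (f : T -> R) :
  measurable A -> (mu A < +oo)%E -> measurable_fun setT f ->
  (forall x, `|f x| <= C) -> (forall x, ~ A x -> f x = 0) ->
  mu.-integrable setT (EFin \o f).
Proof.
move=> mA Aoo mf fC fA.
rewrite (_ : EFin \o f = (EFin \o f) \_ A); last first.
  apply/funext => x; rewrite patchE; case: ifPn => //.
  by rewrite notin_setE => /fA /= ->.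
apply: (integrable_mkcond _ mA).1; apply: measurable_bounded_integrable => //.
  exact: measurable_funTS.
exists C; split; first exact: num_real.
by move=> x Cx y _; apply: le_trans (fC y) _; exact: ltW.
Qed.

(** A directional derivative depends only on the restriction to a line. This moves derivatives
    between a slice and the whole space, and between one real variable and a partial derivative. *)
Lemma is_derive_line {R : realType} (V W : normedModType R) (f : V -> R) (g : W -> R)
    (x v : V) (y w : W) (l : R) :
  (forall h, f (h *: v + x) = g (h *: w + y)) ->
  is_derive y w g l -> is_derive x v f l.
Proof.
move=> fg [dg gl].
have fx : f x = g y by have := fg 0; rewrite !scale0r !add0r.
have E : (fun h => h^-1 *: (f (h *: v + x) - f x)) =
         (fun h => h^-1 *: (g (h *: w + y) - g y)).
  by apply/funext => h; rewrite fg fx.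
by split; [rewrite /derivable E|rewrite /derive E].
Qed.

Lemma deriv_integral0 {R : realType} (H g : R -> R) (M : R) :
  continuous g -> (forall x : R, is_derive x (1 : R) H (g x)) ->
  (forall x, M <= `|x| -> H x = 0) -> (forall x, M <= `|x| -> g x = 0) ->
  (\int[@lebesgue_measure R]_x (g x)%:E = 0)%E.
Proof.
(* [N] exceeds [M] and is positive, so that the interval from [- N] to [N] is nondegenerate even for
   [M <= 0]. *)
move=> cg dH H0 g0; pose N : R := `|M| + 1.
have N0 : 0 < N by rewrite ltr_wpDl.
have MN : M <= N by rewrite (le_trans (ler_norm M))// lerDl.
have NN : - N < N by rewrite gtrN.
have cH : continuous H.
  by move=> x; apply/differentiable_continuous/derivable1_diffP; exact: ex_derive.
transitivity (\int[@lebesgue_measure R]_(x in `[(- N)%R, N]) (g x)%:E)%E.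
  rewrite [RHS]integral_mkcond; apply: eq_integral => x _; rewrite patchE.
  case: ifPn => //; rewrite notin_setE/= in_itv/= -ler_norml => /negP.
  by rewrite -ltNge => /ltW Nx; rewrite g0// (le_trans MN).
rewrite (continuous_FTC2 NN (F := H)).
- by rewrite !H0 ?subee// ?normrN gtr0_norm.
- exact: continuous_subspaceT.
- split; first by move=> x _; exact: ex_derive.
    exact/cvg_at_right_filter/cH.
  exact/cvg_at_left_filter/cH.
- by move=> x _; rewrite derive1E; exact: derive_val.
Qed.

Lemma cvg_rV {R : realType} d (T : Type) (F : set_system T) (f : T -> 'rV[R]_d)
    (l : 'rV[R]_d) : Filter F ->
  (forall i, f x ord0 i @[x --> F] --> l ord0 i) -> f @ F --> l.
Proof.
move=> FF h; apply/cvg_ballP => e e0.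
have : \forall x \near F, forall i : 'I_d, ball (l ord0 i) e (f x ord0 i).
  by apply: filter_forall => i; move/cvg_ballP : (h i); exact.
by apply: filterS => x hx; split=> // i j; rewrite ord1.
Qed.

Lemma continuous_rV {R : realType} d (T : topologicalType) (f : T -> 'rV[R]_d) :
  (forall i, continuous (fun x => f x ord0 i)) -> continuous f.
Proof. by move=> h x; apply: cvg_rV => i; exact: h. Qed.

Lemma continuous_rV_consl {R : realType} d (y : 'rV[R]_d) :
  continuous (fun s : R => rV_cons (s, y)).
Proof.
apply: continuous_rV => i; rewrite /rV_cons.
under eq_fun do rewrite mxE.
by case: unliftP => [j|] _ x; [exact: cst_continuous|exact: cvg_id].
Qed.

Lemma continuous_rV_consr {R : realType} d (s : R) :
  continuous (fun y : 'rV[R]_d => rV_cons (s, y)).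
Proof.
apply: continuous_rV => i; rewrite /rV_cons.
under eq_fun do rewrite mxE.
by case: unliftP => [j|] _ x; [exact: coord_continuous|exact: cst_continuous].
Qed.

Lemma rV_consD0 {R : realType} d (h s : R) (y : 'rV[R]_d) :
  h *: delta_mx ord0 ord0 + rV_cons (s, y) = rV_cons (h *: (1 : R) + s, y).
Proof.
apply/rowP => i; rewrite !mxE eqxx.
case: unliftP => [j ->|->] /=; first by rewrite mulr0 add0r.
by [].
Qed.

Lemma rV_consDS {R : realType} d (h s : R) (j : 'I_d) (y : 'rV[R]_d) :
  h *: delta_mx ord0 (lift ord0 j) + rV_cons (s, y) =
  rV_cons (s, h *: delta_mx ord0 j + y).
Proof.
apply/rowP => i; rewrite !mxE eqxx.
case: unliftP => [k ->|->] /=; first by rewrite !mxE eqxx (inj_eq lift_inj).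
by rewrite mulr0 add0r.
Qed.

Lemma compact_rV_box {R : realType} d (a b : 'I_d -> R) :
  compact [set x : 'rV[R]_d | forall i, a i <= x ord0 i <= b i].
Proof.
have := @rV_compact R d (fun i => `[a i, b i]%classic)
  (fun i => @segment_compact R (a i) (b i)).
by congr compact; apply/seteqP; split => x /= h i; have := h i; rewrite in_itv.
Qed.

Lemma coord_le_norm {R : realType} d (x : 'rV[R]_d) i : `|x ord0 i| <= `|x|.
Proof.
have -> : `|x| = mx_norm x by [].
rewrite mx_normrE.
by apply: (le_bigmax _ (fun k : 'I_1 * 'I_d => `|x k.1 k.2|) (ord0, i)).
Qed.

Lemma compact_sub_rV_box {R : realType} d (K : set 'rV[R]_d) : compact K ->
  exists2 M : R, 0 < M & K `<=` [set x | forall i, `|x ord0 i| < M].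
Proof.
move=> /compact_bounded[M [_ hM]].
exists (`|M| + 1 + 1) => [|x Kx i]; first by rewrite ltr_wpDl// addr_ge0.
rewrite (@le_lt_trans _ _ (`|M| + 1))// ?ltrDl//.
have : `|x| <= `|M| + 1.
  by apply: (hM _ _ x Kx); rewrite (le_lt_trans (ler_norm M))// ltrDl.
by apply: le_trans; exact: coord_le_norm.
Qed.

Lemma lebesgue_rV_cube_lty {R : realType} d (M : R) :
  measurable [set x : 'rV[R]_d | forall i, `|x ord0 i| < M] /\
  (lebesgue_rV d [set x : 'rV[R]_d | forall i, (`|x ord0 i| < M)%R] < +oo)%E.
Proof.
rewrite (_ : [set x | _] = obox (fun=> - M) (fun=> M)); last first.
  by apply/seteqP; split => x /= h i; have := h i; rewrite ltr_norml.
split; first exact: measurable_obox.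
have [M0|M0] := leP 0 M.
  by rewrite lebesgue_obox ?ltry// => i; rewrite ge0_cp.
apply: (@le_lt_trans _ _ (lebesgue_rV d (obox (fun=> -`|M|) (fun=> `|M|)))).
  apply: le_measure; rewrite ?inE; [exact: measurable_obox..|].
  by move=> x h i; have := h i; rewrite ltr0_norm// opprK => /andP[h1 h2]; lra.
by rewrite lebesgue_obox ?ltry// => i; rewrite ge0_cp.
Qed.

Lemma compact_lebesgue_rV_lty {R : realType} d (K : set 'rV[R]_d) :
  compact K -> measurable K /\ (lebesgue_rV d K < +oo)%E.
Proof.
move=> cK; have mK : measurable K.
  apply: closed_measurable_rV; by apply: compact_closed => //; exact: norm_hausdorff.

split => //; have [M M0 KM] := compact_sub_rV_box cK.
have [mM Moo] := @lebesgue_rV_cube_lty R d M.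
by apply: le_lt_trans Moo; apply: le_measure; rewrite ?inE.
Qed.

Lemma continuous_compact_bounded {R : realType} d (K : set 'rV[R]_d)
    (f : 'rV[R]_d -> R) :
  compact K -> continuous f ->
  exists2 C : R, 0 < C & forall x, K x -> `|f x| <= C.
Proof.
move=> cK cf.
have /compact_bounded[C [_ hC]] : compact (f @` K).
  by apply: continuous_compact => //; exact: continuous_subspaceT.
exists (`|C| + 1) => [|x Kx]; first by rewrite ltr_wpDl.
apply: hC; first by rewrite (le_lt_trans (ler_norm C))// ltrDl.
by exists x.
Qed.

Lemma integrable_compact_supp {R : realType} d (K : set 'rV[R]_d)
    (f : 'rV[R]_d -> R) :
  compact K -> continuous f -> (forall x, ~ K x -> f x = 0) ->
  (lebesgue_rV d).-integrable setT (EFin \o f).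
Proof.
move=> cK cf f0; have [mK Koo] := compact_lebesgue_rV_lty cK.
have [C C0 hC] := continuous_compact_bounded cK cf.
apply: (integrable_bounded_support (A := K) (C := C)) => //.
  exact: continuous_measurable_rV.
move=> x; have [Kx|Kx] := pselect (K x); first exact: hC.
by rewrite f0// normr0 ltW.
Qed.

(** Fubini along the recursive definition of [lebesgue_rV]: if [i] is the first coordinate, that
    variable is integrated first, by the fundamental theorem of calculus; otherwise the slice with
    the first variable fixed falls under the induction hypothesis. The support condition is stated
    coordinatewise because slices inherit it in that form. *)
Lemma partial_integral0 {R : realType} d (H G : 'rV[R]_d -> R) (i : 'I_d) (M : R) :
  continuous G -> (forall x : 'rV[R]_d, is_derive x (delta_mx ord0 i) H (G x)) ->
  (forall x : 'rV[R]_d, (exists j, M <= `|x ord0 j|) -> H x = 0) ->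
  (forall x : 'rV[R]_d, (exists j, M <= `|x ord0 j|) -> G x = 0) ->
  (\int[lebesgue_rV d]_x (G x)%:E = 0)%E.
Proof.
elim: d H G i => [|d ih] H G i cG dH H0 G0; first by case: i {dH}.
pose K := [set x : 'rV[R]_d.+1 | forall i, - M <= x ord0 i <= M].
have cK : compact K by exact: compact_rV_box.
have [mK Koo] := compact_lebesgue_rV_lty cK.
have GK x : ~ K x -> G x = 0.
  move=> /existsNP[j] /negP; rewrite -ler_norml -ltNge => /ltW h.
  by apply: G0; exists j.
have [C C0 hC] := continuous_compact_bounded cK cG.
have mG := continuous_measurable_rV cG.
have mcons := @measurable_rV_cons R d.
have iG : (@lebesgue_measure R \x lebesgue_rV d)%E.-integrable setT
    (EFin \o (G \o @rV_cons R d)).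
  apply: (@integrable_bounded_support _ _ R
    (@lebesgue_measure R \x lebesgue_rV d)%E (@rV_cons R d @^-1` K) C).
  - by rewrite -[X in measurable X]setTI; exact: mcons.
  - exact: Koo.
  - exact: measurableT_comp.
  - move=> x; have [Kx|Kx] := pselect (K (rV_cons x)); first exact: hC.
    by rewrite /= GK// normr0 ltW.
  - by move=> x Kx; exact: GK.
rewrite /= /lebesgue_rV_cons integral_pushforward//; last exact/measurable_EFinP.
rewrite preimage_setT.
have cslice1 y : continuous (fun s => G (rV_cons (s, y))).
  move=> s; apply: (@continuous_comp _ _ _ (fun s => rV_cons (s, y)) G).
    exact: continuous_rV_consl.
  exact: cG.
have cslice2 s : continuous (fun y => G (rV_cons (s, y))).
  move=> y; apply: (@continuous_comp _ _ _ (fun y => rV_cons (s, y)) G).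
    exact: continuous_rV_consr.
  exact: cG.
have consS s y (j : 'I_d) : rV_cons (s, y) ord0 (lift ord0 j) = y ord0 j.
  by rewrite mxE liftK.
have cons0 s y : @rV_cons R d (s, y) ord0 ord0 = s.
  by rewrite mxE unlift_none.
have := unliftP ord0 i; case=> [j|] Ei; subst i.
  rewrite -integral12_prod_meas1//=.
  rewrite (eq_integral (cst 0%E)) ?integral0// => s _.
  apply: (ih (fun y => H (rV_cons (s, y))) (fun y => G (rV_cons (s, y))) j) => //.
  - move=> y.
    apply: (@is_derive_line R 'rV[R]_d 'rV[R]_d.+1 (fun y => H (rV_cons (s, y)))
      H y _ (rV_cons (s, y)) _ _ _ (dH _)) => h.
    by rewrite rV_consDS.
  - by move=> y [k hk]; apply: H0; exists (lift ord0 k); rewrite consS.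
  - by move=> y [k hk]; apply: G0; exists (lift ord0 k); rewrite consS.
rewrite -integral21_prod_meas1//=.
rewrite (eq_integral (cst 0%E)) ?integral0// => y _.
apply: (@deriv_integral0 _ (fun s => H (rV_cons (s, y))) _ M) => //.
- move=> s.
  apply: (@is_derive_line R R 'rV[R]_d.+1 (fun s => H (rV_cons (s, y)))
    H s _ (rV_cons (s, y)) _ _ _ (dH _)) => h.
  by rewrite rV_consD0.
- by move=> s hs; apply: H0; exists ord0; rewrite cons0.
- by move=> s hs; apply: G0; exists ord0; rewrite cons0.
Qed.

Lemma continuousM_rV {R : realType} (T : topologicalType) (f g : T -> R) :
  continuous f -> continuous g -> continuous (fun x => f x * g x).
Proof. by move=> cf cg x; apply: cvgM; [exact: cf|exact: cg]. Qed.

Lemma Rintegral_supp {d} {T : measurableType d} {R : realType}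
    (mu : {measure set T -> \bar R}) (D : set T) (f : T -> R) :
  (forall x, ~ D x -> f x = 0) ->
  \int[mu]_(x in D) f x = \int[mu]_x f x.
Proof.
move=> f0; rewrite Rintegral_mkcond; apply: eq_Rintegral => x _.
by rewrite patchE; case: ifPn => //; rewrite notin_setE => /f0.
Qed.

Lemma Rintegral_parts_rV {R : realType} d (K : set 'rV[R]_d) (i : 'I_d)
    (f f' psi psi' : 'rV[R]_d -> R) :
  compact K -> continuous f -> continuous f' -> continuous psi -> continuous psi' ->
  (forall x : 'rV[R]_d, is_derive x (delta_mx ord0 i) f (f' x)) ->
  (forall x : 'rV[R]_d, is_derive x (delta_mx ord0 i) psi (psi' x)) ->
  (forall x, ~ K x -> psi x = 0) -> (forall x, ~ K x -> psi' x = 0) ->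
  \int[lebesgue_rV d]_x (f x * psi' x) = - \int[lebesgue_rV d]_x (f' x * psi x).
Proof.
move=> cK cf cf' cp cp' df dp p0 p0'.
have c1 := continuousM_rV cf' cp; have c2 := continuousM_rV cf cp'.
have i1 : (lebesgue_rV d).-integrable setT (EFin \o (fun x => f' x * psi x)).
  by apply: (integrable_compact_supp cK c1) => x /p0 ->; rewrite mulr0.
have i2 : (lebesgue_rV d).-integrable setT (EFin \o (fun x => f x * psi' x)).
  by apply: (integrable_compact_supp cK c2) => x /p0' ->; rewrite mulr0.
apply/eqP; rewrite -addr_eq0 -RintegralD//; apply/eqP.
rewrite /Rintegral; have [M M0 KM] := compact_sub_rV_box cK.
have nK (x : 'rV[R]_d) : (exists j : 'I_d, M <= `|x ord0 j|) -> ~ K x.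
  by move=> [j Mj] /KM /(_ j); rewrite ltNge Mj.
suff -> : (\int[lebesgue_rV d]_x (f x * psi' x + f' x * psi x)%:E = 0)%E by [].
apply: (@partial_integral0 R d (fun x => f x * psi x) _ i M).
- by move=> x; exact: (cvgD (c2 x) (c1 x)).
- move=> x; have := is_deriveM (df x) (dp x).
  rewrite /GRing.scale/= => h; rewrite [f' x * _]mulrC; exact: h.
- by move=> x /nK /p0 ->; rewrite mulr0.
- by move=> x /nK nKx; rewrite p0// p0'// !mulr0 addr0.
Qed.

(** * Families of iterated derivatives and their weak formulation *)

Definition incr {d} (beta : 'I_d -> nat) (i : 'I_d) : 'I_d -> nat :=
  fun j => ((j == i) + beta j)%N.

Definition add_count {d} (s : seq 'I_d) (beta : 'I_d -> nat) : 'I_d -> nat :=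
  fun j => (count_mem j s + beta j)%N.

Lemma add_count_consl {d} i (s : seq 'I_d) beta :
  add_count (i :: s) beta = incr (add_count s beta) i.
Proof. by apply/funext => j; rewrite /add_count /incr /= addnA eq_sym. Qed.

(** [partials (i :: s)] differentiates in direction [i] last, which is the form of
    [add_count_consl]; integration by parts removes this outermost derivative first and increases
    [beta] before the rest of [s] is treated. *)
Lemma add_count_consr {d} i (s : seq 'I_d) beta :
  add_count (i :: s) beta = add_count s (incr beta i).
Proof.
by apply/funext => j; rewrite /add_count /incr /= addnCA addnA eq_sym.
Qed.

Section derivative_family.
Context {R : realType} {d : nat}.
Implicit Types (F : ('I_d -> nat) -> 'rV[R]_d -> R) (Omega : set 'rV[R]_d).

(* F beta is the derivative of order beta of F 0. *)
Definition derivative_family F : Prop := forall beta,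
  continuous (F beta) /\
  forall i (x : 'rV[R]_d), is_derive x (delta_mx ord0 i) (F beta) (F (incr beta i) x).

(** Since the family is indexed by multi-indices, the order of differentiation is irrelevant from
    the start and the symmetry of mixed derivatives need not be invoked. *)
Lemma partials_family F s beta : derivative_family F ->
  partials s (F beta) = F (add_count s beta).
Proof.
move=> hF; elim: s => [|i s ih]; first by congr F; apply/funext.
rewrite /= -/(partials s _) ih add_count_consl; apply/funext => x.
have [_ /(_ i x) h] := hF (add_count s beta).
by rewrite /partial (@derive_val _ _ _ _ _ _ _ h).
Qed.

Lemma smooth_family F beta : derivative_family F -> smooth (F beta).
Proof.
move=> hF s; rewrite partials_family//; have [h1 h2] := hF (add_count s beta).
by split => // i x; exact: (@ex_derive _ _ _ _ _ _ _ (h2 i x)).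
Qed.

Lemma partials_supp (phi : 'rV[R]_d -> R) s (x : 'rV[R]_d) :
  ~ closure [set x | phi x != 0] x -> partials s phi x = 0.
Proof.
set K := closure _.
have oK : open (~` K) by rewrite openC; exact: closed_closure.
elim: s x => [|i s ih] x Kx.
  by apply/eqP/negPn/negP => px; apply: Kx; exact: subset_closure.
rewrite /= /partial -(derive_cst (0 : R) x (delta_mx ord0 i)).
apply: near_eq_derive; near=> y; apply: ih; near: y.
exact: open_nbhs_nbhs.
Unshelve. all: by end_near. Qed.

Lemma Rintegral_parts_family F Omega phi s beta :
  derivative_family F -> test_function Omega phi ->
  \int[lebesgue_rV d]_(x in Omega) (F beta x * partials s phi x) =
  (-1) ^+ size s * \int[lebesgue_rV d]_(x in Omega) (F (add_count s beta) x * phi x).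
Proof.
move=> hF [sphi cphi phiO].
(* All integrands vanish outside [Omega] with the derivatives of [phi], so the integrals may be
   taken over the whole space, where integration by parts is available. *)
have supp r b x : ~ Omega x -> F b x * partials r phi x = 0.
  by move=> Ox; rewrite partials_supp ?mulr0// => /phiO.
rewrite [LHS]Rintegral_supp; last by move=> x /supp.
rewrite [in RHS]Rintegral_supp; last by move=> x /(supp [::] (add_count s beta)).
elim: s beta => [|i s ih] beta.
  by rewrite mul1r; congr (Rintegral _ _ _); apply/funext => x;
    congr (F _ _ * _); apply/funext.
have [cs ds] := sphi s; have [cs' _] := sphi (i :: s).
have [cF dF] := hF beta; have [cF' _] := hF (incr beta i).
transitivity (- \int[lebesgue_rV d]_x (F (incr beta i) x * partials s phi x)).
  apply: (Rintegral_parts_rV cphi cF cF' cs cs') => x; first exact: dF.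
  - exact/derivableP/ds.
  - exact: partials_supp.
  - exact: partials_supp.
by rewrite ih add_count_consr exprS -mulNr mulN1r.
Qed.

Lemma continuous_locally_integrable (f : 'rV[R]_d -> R) Omega :
  continuous f -> locally_integrable_rV Omega f.
Proof.
move=> cf; have mf := continuous_measurable_rV cf; split.
  exact: measurable_funTS.
move=> K KO cK; have [mK Koo] := compact_lebesgue_rV_lty cK.
have [C C0 hC] := continuous_compact_bounded cK cf.
have : (lebesgue_rV d).-integrable K (EFin \o f).
  apply: measurable_bounded_integrable => //; first exact: measurable_funTS.
  exists C; split; first exact: num_real.
  by move=> x Cx y Ky; apply: le_trans (hC y Ky) _; exact: ltW.
by move=> /integrableP[_].
Qed.

Lemma count_mem_multi (alpha : 'I_d -> nat) (j : 'I_d) :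
  count_mem j (flatten [seq nseq (alpha i) i | i <- enum 'I_d]) = alpha j.
Proof.
rewrite count_flatten -map_comp sumnE big_map big_enum/=.
rewrite (bigD1 j)//= count_nseq /= eqxx mul1n big1 ?addn0// => i ij.
by rewrite count_nseq/= (negbTE ij).
Qed.

Lemma size_multi (alpha : 'I_d -> nat) :
  size (flatten [seq nseq (alpha i) i | i <- enum 'I_d]) = (\sum_i alpha i)%N.
Proof.
rewrite size_flatten /shape -map_comp sumnE big_map big_enum/=.
by apply: eq_bigr => i _; rewrite size_nseq.
Qed.

Lemma weak_derivative_family F Omega alpha : derivative_family F ->
  weak_derivative Omega alpha (F (fun=> 0%N)) (F alpha).
Proof.
move=> hF; split.
- by apply: continuous_locally_integrable; have [] := hF (fun=> 0%N).
- by apply: continuous_locally_integrable; have [] := hF alpha.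
move=> phi hphi; rewrite /multi_partial Rintegral_parts_family// size_multi.
congr (_ * Rintegral _ _ _); apply/funext => x; congr (F _ _ * _).
by apply/funext => j; rewrite /add_count count_mem_multi addn0.
Qed.

End derivative_family.

(** * Uniqueness of weak derivatives *)

Section tensor.
Context {R : realType} {d : nat}.
Implicit Types (eta : 'I_d -> R -> R).

Definition tensor eta (beta : 'I_d -> nat) (x : 'rV[R]_d) : R :=
  \prod_i derive1n (beta i) (eta i) (x ord0 i).

Lemma continuous_prod_rV (I : Type) (s : seq I) (F : I -> 'rV[R]_d -> R) :
  (forall i, continuous (F i)) -> continuous (fun x => \prod_(i <- s) F i x).
Proof.
move=> cF; elim: s => [|i s ih].
  by under eq_fun do rewrite big_nil; move=> x; exact: cst_continuous.
by under eq_fun do rewrite big_cons; exact: continuousM_rV.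
Qed.

Lemma tensor_family eta : (forall i, smooth1 (eta i)) ->
  derivative_family (tensor eta).
Proof.
move=> sm beta; split.
  apply: continuous_prod_rV => i x.
  apply: (@continuous_comp _ _ _ (fun x : 'rV[R]_d => x ord0 i)
    (derive1n (beta i) (eta i))).
    exact: coord_continuous.
  exact: smooth1_continuous.
(* Along a line in direction [i] only the i-th factor varies; [P] collects the others. *)
move=> i x; pose P := \prod_(j | j != i) derive1n (beta j) (eta j) (x ord0 j).
apply: (@is_derive_line R 'rV[R]_d R (tensor eta beta)
  (fun s => P *: derive1n (beta i) (eta i) s) x _ (x ord0 i) 1) => [h|].
  rewrite /tensor (bigD1 i)//= [LHS]mulrC; congr (_ * _); last first.
    by rewrite !mxE !eqxx.
  by apply: eq_bigr => j ji; rewrite !mxE (negbTE ji) andbF mulr0 add0r.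
rewrite [X in is_derive _ _ _ X](_ : _ = P *: derive1n (beta i).+1 (eta i) (x ord0 i)).
  exact/is_deriveZ/smooth1_is_derive/sm.
rewrite /tensor (bigD1 i)//= [LHS]mulrC; congr (_ * _); last first.
  by rewrite /incr eqxx.
by apply: eq_bigr => j ji; rewrite /incr (negbTE ji).
Qed.

Lemma family_sum (n : nat) (c : nat -> R) (F : nat -> ('I_d -> nat) -> 'rV[R]_d -> R) :
  (forall j, derivative_family (F j)) ->
  derivative_family (fun beta x => \sum_(j < n) c j * F j beta x).
Proof.
move=> hF beta; elim: n => [|n [ih1 ih2]].
  split; first by under eq_fun do rewrite big_ord0; move=> x; exact: cst_continuous.
  move=> i x; rewrite big_ord0.
  rewrite (_ : (fun y => _) = cst 0); first exact: is_derive_cst.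
  by apply/funext => y; rewrite big_ord0.
have [h1 h2] := hF n beta.
have E b : (fun x => \sum_(j < n.+1) c j * F j b x) =
    (fun x => \sum_(j < n) c j * F j b x + c n *: F n b x).
  by apply/funext => y; rewrite big_ord_recr.
rewrite E; split.
  move=> x; exact: (cvgD (ih1 x) (cvgZr (h1 x))).
move=> i x; rewrite big_ord_recr/=.
exact: (is_deriveD (ih2 i x) (is_deriveZ (c n) (h2 i x))).
Qed.

Definition cbox (a b : 'I_d -> R) : set 'rV[R]_d :=
  [set x | forall i, a i <= x ord0 i <= b i].

Lemma closed_cbox a b : closed (cbox a b).
Proof.
apply: compact_closed; first exact: norm_hausdorff.
exact: compact_rV_box.
Qed.

Lemma test_function_supp Omega a b (f : 'rV[R]_d -> R) : smooth f ->
  cbox a b `<=` Omega -> (forall x, ~ cbox a b x -> f x = 0) ->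
  test_function Omega f.
Proof.
move=> sf abO f0.
have supp : closure [set x | f x != 0] `<=` cbox a b.
  rewrite [X in _ `<=` X]((closure_id _).1 (@closed_cbox a b)).
  apply: closure_subset => x /= /eqP fx; apply: contrapT => /f0; exact.
split=> //; last exact: subset_trans supp abO.
apply: (subclosed_compact _ (@compact_rV_box R d a b)) => //.
exact: closed_closure.
Qed.

Definition bumps (a b : 'I_d -> R) (k : R) : 'rV[R]_d -> R :=
  tensor (fun i => bump (a i) (b i) k) (fun=> 0%N).

Lemma bumpsE a b k x : bumps a b k x = \prod_i bump (a i) (b i) k (x ord0 i).
Proof. by []. Qed.

Lemma bumps_eq0 a b k x : 0 < k -> ~ obox a b x -> bumps a b k x = 0.
Proof.
move=> k0 /existsNP[i /negP xi].
by rewrite bumpsE (bigD1 i)//= bump_eq0 ?mul0r.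
Qed.

Lemma test_function_bumps Omega a b k : 0 < k -> cbox a b `<=` Omega ->
  test_function Omega (bumps a b k).
Proof.
move=> k0 abO; apply: test_function_supp abO _.
  by apply/smooth_family/tensor_family => i; exact: smooth1_bump.
move=> x nx; apply: bumps_eq0 => // xab; apply: nx => i.
by have /andP[/ltW -> /ltW ->] := xab i.
Qed.

Lemma continuous_bumps a b k : continuous (bumps a b k).
Proof.
apply: (@tensor_family (fun i => bump (a i) (b i) k) _ (fun=> 0%N)).1 => i.
exact: smooth1_bump.
Qed.

Lemma bumps_le1 a b k x : `|bumps a b k x| <= 1.
Proof.
rewrite bumpsE normr_prod; apply: prodr_ile1 => i _.
by rewrite normr_ge0 ger0_norm ?bump_ge0 ?bump_le1.
Qed.

Lemma bumps_cvg a b x :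
  bumps a b n.+1%:R x @[n --> \oo] --> (\1_(obox a b) x : R).
Proof.
rewrite indicE; have [xab|xab] := pselect (obox a b x); last first.
  rewrite memNset//; under eq_fun do rewrite bumps_eq0 ?ltr0n//.
  exact: cvg_cst.
rewrite mem_set//.
suff H (s : seq 'I_d) :
    \prod_(i <- s) bump (a i) (b i) n.+1%:R (x ord0 i) @[n --> \oo] --> (1 : R).
  exact: H.
elim: s => [|i s ih].
  by under eq_fun do rewrite big_nil; exact: cvg_cst.
have E : (fun n : nat => \prod_(j <- i :: s) bump (a j) (b j) n.+1%:R (x ord0 j)) =
    (fun n => bump (a i) (b i) n.+1%:R (x ord0 i)) \*
    (fun n => \prod_(j <- s) bump (a j) (b j) n.+1%:R (x ord0 j)).
  by apply/funext => n; rewrite big_cons.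
have := cvgM (bump_cvg1 (xab i)) ih.
by rewrite mulr1 E; exact.
Qed.

End tensor.

(** * The fundamental lemma of the calculus of variations on boxes *)

Section fundamental_lemma.
Context {R : realType} {d : nat}.
Implicit Types (a b : 'I_d -> R).

Definition oboxes : set_system 'rV[R]_d := [set A | exists a b, A = obox a b].

Lemma setI_obox a b a' b' : obox a b `&` obox a' b' =
  obox (fun i => Num.max (a i) (a' i)) (fun i => Num.min (b i) (b' i)) :> set 'rV[R]_d.
Proof.
apply/seteqP; split => x.
  move=> [h1 h2] i; rewrite gt_max lt_min.
  by have /andP[-> ->] := h1 i; have /andP[-> ->] := h2 i.
move=> h; split => i; have := h i; rewrite gt_max lt_min.
  by move=> /andP[/andP[-> _] /andP[-> _]].
by move=> /andP[/andP[_ ->] /andP[_ ->]].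
Qed.

Lemma setI_closed_oboxes : setI_closed oboxes.
Proof.
move=> _ _ [a [b ->]] [a' [b' ->]]; rewrite setI_obox.
by eexists; eexists; reflexivity.
Qed.

(** Boxes generate the sigma-algebra: prescribing an interval for one coordinate gives a strip, the
    union over [n] of boxes whose other sides are ]-n, n[. *)
Lemma measurable_sub_oboxes (A : set 'rV[R]_d) :
  measurable A -> oboxes.-sigma.-measurable A.
Proof.
move=> mA.
have coord i : measurable_fun [set: g_sigma_algebraType oboxes]
    (fun x : g_sigma_algebraType oboxes => (x : 'rV[R]_d) ord0 i).
  apply: (measurability _ (RGenOpens.measurableE R)).
  move=> _ [_ [u [v ->] <-]]; rewrite setTI.
  rewrite (_ : _ @^-1` _ = \bigcup_n
     (obox (fun j => if j == i then u else - n%:R)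
           (fun j => if j == i then v else n%:R) : set 'rV[R]_d)).
    apply: bigcup_measurable => n _; apply: sub_sigma_algebra.
    by eexists; eexists; reflexivity.
  apply/seteqP; split => [x|x [n _]] /=; rewrite in_itv/=; last first.
    by move=> /(_ i); rewrite eqxx.
  move=> xuv; exists (Num.bound `|x|) => // j; case: eqVneq => [->//|_].
  rewrite -ltr_norml; apply: le_lt_trans (archi_boundP (normr_ge0 x)).
  exact: coord_le_norm.
have := measurable_fun_rVP coord; rewrite /= => H.
by have := H measurableT A mA; rewrite setTI.
Qed.

(** Applied twice: to the indicators of an increasing sequence of sets, and to bumps tending to the
    indicator of a box. *)
Lemma dominated_integral0 {dT} {T : measurableType dT} (mu : {measure set T -> \bar R})
    (O : set T) (h : T -> R) (u_ : nat -> T -> R) (u : T -> R) :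
  measurable O -> mu.-integrable O (EFin \o h) ->
  (forall n, measurable_fun O (u_ n)) -> measurable_fun O u ->
  (forall n x, `|u_ n x| <= 1) -> (forall x, u_ n x @[n --> \oo] --> u x) ->
  (forall n, \int[mu]_(x in O) (h x * u_ n x)%:E = 0)%E ->
  (\int[mu]_(x in O) (h x * u x)%:E = 0)%E.
Proof.
move=> mO ih mu_ mmu u1 uu h0.
have mh : measurable_fun O h by exact/measurable_EFinP/(measurable_int _ ih).
have [|||||_ _ cv] := @dominated_convergence _ _ R mu O mO
    (fun n x => (h x * u_ n x)%:E) (fun x => (h x * u x)%:E)
    (fun x => `|(h x)%:E|)%E.
- by move=> n; apply/measurable_EFinP; exact: measurable_funM.
- by apply/measurable_EFinP; exact: measurable_funM.
- apply/aeW => x Ox; apply: cvg_EFin; first exact: nearW.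
  by apply: cvgMr; exact: uu.
- exact: integrable_abse.
- apply/aeW => x n Ox /=; rewrite lee_fin normrM -[leRHS]mulr1.
  by rewrite ler_wpM2l.
have := cvg_lim (@ereal_hausdorff R) cv; rewrite /= => <-.
rewrite (_ : (fun n => _) = cst 0%E); last by apply/funext => n; exact: h0.
exact: lim_cst.
Qed.

(** The sets over whose intersection with the box [h] integrates to 0 form a lambda-system. It
    contains all boxes, which are stable under intersection and generate the measurable sets, so the
    integral of [h] vanishes on every measurable part of the box. *)
Lemma integral_obox_ae0 a b (h : 'rV[R]_d -> R) :
  let mu := lebesgue_rV d in
  mu.-integrable (obox a b) (EFin \o h) ->
  (forall a' b', (forall i, a i <= a' i /\ b' i <= b i) ->
     (\int[mu]_(x in obox a' b') (h x)%:E = 0)%E) ->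
  ae_eq mu (obox a b) (EFin \o h) (cst 0%E).
Proof.
move=> mu ih h0; set O := obox a b.
have mO : measurable O by exact: measurable_obox.
pose H : set_system 'rV[R]_d := [set A | measurable A /\
  (\int[mu]_(x in O) (h x * \1_A x)%:E = 0)%E].
have mh : measurable_fun O h by move: ih => /measurable_int/measurable_EFinP.
have HE A : measurable A ->
    (\int[mu]_(x in O) (h x * \1_A x)%:E = \int[mu]_(x in O `&` A) (h x)%:E)%E.
  move=> mA; rewrite [RHS]integral_mkcondr; apply: eq_integral => x _.
  rewrite patchE indicE; case: ifPn => _; first by rewrite mulr1.
  by rewrite mulr0.
have iA A : measurable A -> mu.-integrable O (fun x => (h x * \1_A x)%:E).
  move=> mA; apply: (le_integrable mO _ _ ih) => //.
    by apply/measurable_EFinP/measurable_funM => //; exact: measurable_indic.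
  move=> x Ox; rewrite /= lee_fin normrM indicE -[leRHS]mulr1 ler_wpM2l//.
  by case: (_ \in _); rewrite ?normr1 ?normr0.
have lH : lambda_system setT H.
  split => //.
  - split => //; rewrite HE// setIT; exact: h0.
  - move=> A B BA [mA A0] [mB B0]; split; first exact: measurableD.
    have E x : h x * \1_(A `\` B) x = h x * \1_A x - h x * \1_B x.
      rewrite !indicE in_setD.
      have [xB|xB] := boolP (x \in B); last by rewrite mulr0 subr0 andbT.
      rewrite andbF mulr0 (_ : x \in A) ?subrr//.
      by move: xB; rewrite !inE; exact: BA.
    under eq_integral do rewrite E EFinB.
    by rewrite integralB ?A0 ?B0 ?subee//; exact: iA.
  - move=> F ndF HF.
    have mF n : measurable (F n) by have [] := HF n.
    have mUF : measurable (\bigcup_n F n) by exact: bigcup_measurable.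
    split => //; apply: (@dominated_integral0 _ _ mu O h (fun n => \1_(F n))) => //.
    + move=> n x; rewrite indicE; case: (_ \in _); rewrite ?normr1 ?normr0//.
    + move=> x; have [[n _ Fnx]|nF] := pselect ((\bigcup_n F n) x).
        apply: cvg_near_cst; exists n => // k /= nk.
        rewrite !indicE !mem_set//; first by exists n.
        by have /subsetPset := ndF _ _ nk; apply.
      apply: cvg_near_cst; apply: nearW => k.
      by rewrite !indicE !memNset// => Fkx; apply: nF; exists k.
    + by move=> n; have [] := HF n.
have GH : oboxes `<=` H.
  move=> _ [a' [b' ->]]; split; first exact: measurable_obox.
  rewrite HE; last exact: measurable_obox.
  rewrite setI_obox; apply: h0 => i.
  by rewrite le_max lexx ge_min lexx.
have sH : measurable `<=` H.
  move=> A /measurable_sub_oboxes; apply: (lambda_system_subset setI_closed_oboxes lH GH).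
  by [].
apply: integral_ae_eq => // E EO mE.
have [_] := sH _ mE; rewrite HE// (_ : O `&` E = E); last exact/setIidr.
by move=> ->; rewrite integral0.
Qed.

Lemma locally_integrable_cbox (Omega : set 'rV[R]_d) a b (g : 'rV[R]_d -> R) :
  open Omega -> cbox a b `<=` Omega -> locally_integrable_rV Omega g ->
  (lebesgue_rV d).-integrable (obox a b) (EFin \o g).
Proof.
move=> oO abO [mg ig].
have mO := open_measurable_rV oO.
have cK := @compact_rV_box R d a b.
have [mK _] := compact_lebesgue_rV_lty cK.
apply: (@integrableS _ _ _ _ (cbox a b)) => //; first exact: measurable_obox.
  by move=> x h i; have /andP[/ltW -> /ltW ->] := h i.
apply/integrableP; split.
  by apply/measurable_EFinP; apply: measurable_funS mg.
exact: ig.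
Qed.

(** Tested against steeper and steeper bumps on a sub-box, both versions give the same integrals; in
    the limit [g1 - g2] integrates to 0 over each sub-box. The box is closed inside [Omega] so that
    local integrability becomes integrability on it. *)
Lemma weak_derivative_unique (Omega : set 'rV[R]_d) alpha f g1 g2 a b :
  open Omega -> cbox a b `<=` Omega ->
  weak_derivative Omega alpha f g1 -> weak_derivative Omega alpha f g2 ->
  ae_eq (lebesgue_rV d) (obox a b) (EFin \o g1) (EFin \o g2).
Proof.
move=> oO abO [_ l1 w1] [_ l2 w2]; set mu := lebesgue_rV d.
have lim_box a' b' (g : 'rV[R]_d -> R) : cbox a' b' `<=` Omega ->
    locally_integrable_rV Omega g ->
  forall k : R, 0 < k -> mu.-integrable (obox a' b') (fun x => (g x * bumps a' b' k x)%:E).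
  move=> abO' lg k k0; have ig := locally_integrable_cbox oO abO' lg.
  have mO := @measurable_obox R d a' b'.
  apply: (le_integrable mO _ _ ig).
    apply/measurable_EFinP/measurable_funM.
      by move: ig => /measurable_int/measurable_EFinP.
    by apply: measurable_funTS; apply: continuous_measurable_rV; exact: continuous_bumps.
  move=> x _; rewrite /= lee_fin normrM -[leRHS]mulr1 ler_wpM2l//.
  exact: bumps_le1.
have i1 := locally_integrable_cbox oO abO l1.
have i2 := locally_integrable_cbox oO abO l2.
have mO := @measurable_obox R d a b.
suff ae0 : ae_eq mu (obox a b) (EFin \o (g1 \- g2)) (cst 0%E).
  apply: filterS ae0 => x h Ox; have := h Ox; rewrite /= => -[] /eqP.
  by rewrite subr_eq0 => /eqP ->.
apply: integral_obox_ae0.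
  have := integrableB mO i1 i2; exact: eq_integrable.
move=> a' b' sub; set O' := obox a' b'.
have mO' : measurable O' by exact: measurable_obox.
have abO' : cbox a' b' `<=` Omega.
  apply: subset_trans abO => x h i; have [h1 h2] := sub i.
  by have /andP[h3 h4] := h i; rewrite (le_trans h1)//= (le_trans h4).
have i1' := locally_integrable_cbox oO abO' l1.
have i2' := locally_integrable_cbox oO abO' l2.
have ih : mu.-integrable O' (EFin \o (g1 \- g2)).
  have := integrableB mO' i1' i2'; exact: eq_integrable.
have bump0 k x : 0 < k -> ~ O' x -> bumps a' b' k x = 0 by exact: bumps_eq0.
rewrite (eq_integral (fun x => ((g1 \- g2) x * \1_O' x)%:E)); last first.
  by move=> x xO; rewrite indicE xO mulr1.
apply: (@dominated_integral0 _ _ mu O' (g1 \- g2) (fun n => bumps a' b' n.+1%:R)) => //.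
- move=> n; apply: measurable_funTS; apply: continuous_measurable_rV.
  exact: continuous_bumps.
- by move=> n x; exact: bumps_le1.
- exact: bumps_cvg.
move=> n; set phi := bumps _ _ _.
have n0 : 0 < n.+1%:R :> R by rewrite ltr0n.
have tphi : test_function Omega phi by exact: test_function_bumps.
have I1 := lim_box _ _ _ abO' l1 _ n0; have I2 := lim_box _ _ _ abO' l2 _ n0.
have RO g : \int[mu]_(x in Omega) (g x * phi x) = \int[mu]_(x in O') (g x * phi x).
  rewrite [LHS]Rintegral_supp; last first.
    move=> x Ox; rewrite [phi x]bump0 ?mulr0// => O'x; apply: Ox; apply: abO' => i.
    by have /andP[/ltW -> /ltW ->] := O'x i.
  by rewrite [RHS]Rintegral_supp// => x O'x; rewrite [phi x]bump0 ?mulr0.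
have : \int[mu]_(x in O') (g1 x * phi x) = \int[mu]_(x in O') (g2 x * phi x).
  rewrite -!RO; apply: (@mulfI _ ((-1) ^+ (\sum_i alpha i)%N)).
    by rewrite signr_eq0.
  by rewrite -w1// -w2.
rewrite /Rintegral => E12.
under eq_integral do rewrite mulrBl EFinB.
rewrite integralB//.
rewrite -[X in (X - _)%E]fineK; last exact: integrable_fin_num.
rewrite -[X in (_ - X)%E]fineK; last exact: integrable_fin_num.
by rewrite E12 -EFinB subrr.
Qed.

End fundamental_lemma.

(** * Lorentz quasi-norms of lacunary sums *)

(* No measurability is assumed, which spares proving that rearrangements are
   measurable. *)
Lemma le_integral_nonneg {dT} {T : measurableType dT} {R : realType}
    (mu : {measure set T -> \bar R}) (D : set T) (f g : T -> \bar R) :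
  (forall x, D x -> 0 <= f x <= g x)%E ->
  (\int[mu]_(x in D) f x <= \int[mu]_(x in D) g x)%E.
Proof.
move=> fg; rewrite !ge0_integralE; last 2 first.
- by move=> x /fg /andP[]; exact: le_trans.
- by move=> x /fg /andP[].
apply: ereal_sup_le => _ [h hf <-]; exists h => // x; apply: le_trans (hf x) _.
rewrite !patchE; case: ifPn => // xD.
by have /andP[] := fg x (set_mem xD).
Qed.

Section powR_integral.
Context {R : realType}.
Notation mu := (@lebesgue_measure R).

Lemma measurable_powR_itv (a : R) (D : set R) :
  measurable_fun D (fun t => (t `^ a)%:E : \bar R).
Proof.
by apply/measurable_EFinP; apply: measurable_funTS; exact: measurable_powR.
Qed.

(** Away from 0 the fundamental theorem of calculus applies; the nonnegative value of the primitive
    at [e] is dropped, so the bound is uniform in [e]. *)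
Lemma integral_powR_itvcc (a s e : R) : 0 < a -> 0 < e -> e < s ->
  (\int[mu]_(t in `[e, s]) (t `^ (a - 1))%:E <= (a^-1 * s `^ a)%:E)%E.
Proof.
move=> a0 e0 es; have s0 := lt_trans e0 es.
have c x b : 0 < x -> {for x, continuous (fun t : R => t `^ b)}.
  move=> x0; apply/differentiable_continuous/derivable1_diffP.
  by apply: (@ex_derive _ _ _ _ _ _ _ (is_derive1_powR b x0)).
have cF x : 0 < x -> {for x, continuous (fun t : R => a^-1 * t `^ a)}.
  by move=> x0; apply: continuousM; [exact: cst_continuous|exact: c].
rewrite (continuous_FTC2 es (F := fun t => a^-1 * t `^ a)).
- by rewrite -EFinB lee_fin gerBl mulr_ge0 ?powR_ge0// invr_ge0 ltW.
- apply: continuous_in_subspaceT => x; rewrite inE/= in_itv/= => /andP[ex _].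
  by apply: c; exact: lt_le_trans ex.
- split.
  + move=> x; rewrite in_itv/= => /andP[ex _].
    have D := is_deriveZ (a^-1) (is_derive1_powR a (lt_trans e0 ex)).
    exact: (@ex_derive _ _ _ _ _ _ _ D).
  + exact/cvg_at_right_filter/cF.
  + exact/cvg_at_left_filter/cF.
- move=> x; rewrite in_itv/= => /andP[ex _]; rewrite derive1E.
  have D := is_deriveZ (a^-1) (is_derive1_powR a (lt_trans e0 ex)).
  apply: etrans (@derive_val _ _ _ _ _ _ _ D) _.
  by rewrite /GRing.scale/= mulrA mulVf ?mul1r ?gt_eqF.
Qed.

Lemma integral_powR_itvoo (a s : R) : 0 < a -> 0 < s ->
  (\int[mu]_(t in `]0%R, s[) (t `^ (a - 1))%:E <= (a^-1 * s `^ a)%:E)%E.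
Proof.
move=> a0 s0.
(* The intervals exhaust ]0, s[ from the right, since the integrand may blow up at 0; [n.+2] keeps
   the left end strictly below [s] already for [n = 0]. *)
pose F (n : nat) := `[s / n.+2%:R, s]%classic : set R.
have ndF : nondecreasing_seq F.
  move=> m n mn; apply/subsetPset => x; rewrite /F/= !in_itv/= => /andP[h ->].
  rewrite andbT (le_trans _ h)// ler_pM2l// lef_pV2 ?posrE ?ltr0n//.
  by rewrite ler_nat !ltnS.
have cv : (\int[mu]_(t in F n) (t `^ (a - 1))%:E @[n --> \oo] -->
    \int[mu]_(t in \bigcup_n F n) (t `^ (a - 1))%:E)%E.
  apply: ge0_nondecreasing_set_cvg_integral => //.
  - by move=> n; exact: measurable_itv.
  - by move=> n; exact: measurable_powR_itv.
  - by move=> n x _; rewrite lee_fin powR_ge0.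
apply: (@le_trans _ _ (\int[mu]_(t in \bigcup_n F n) (t `^ (a - 1))%:E)%E).
  apply: ge0_subset_integral => //.
  - by apply: bigcup_measurable => n _; exact: measurable_itv.
  - exact: measurable_powR_itv.
  - by move=> x _; rewrite lee_fin powR_ge0.
  - move=> x; rewrite /= in_itv/= => /andP[x0 xs].
    exists (Num.bound (s / x)) => //; rewrite /F/= in_itv/= (ltW xs) andbT.
    rewrite ler_pdivrMr ?ltr0n// mulrC -ler_pdivrMr//.
    have := archi_boundP (ltW (divr_gt0 s0 x0)) => /ltW /le_trans; apply.
    by rewrite ler_nat -addn2 leq_addr.
have <- := cvg_lim (@ereal_hausdorff R) cv.
apply: lime_le; first by apply/cvg_ex; eexists; exact: cv.
apply: nearW => n; apply: integral_powR_itvcc => //; first by rewrite divr_gt0.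
by rewrite ltr_pdivrMr// ltr_pMr// ltr1n.
Qed.

End powR_integral.

Section lorentz_general.
Context {dp : measure_display} {T : measurableType dp} {R : realType}.
Variable mu : {measure set T -> \bar R}.
Implicit Types (D : set T) (f : T -> R).

Lemma rearrangement_ge0 D f t : (0 <= rearrangement mu D f t)%E.
Proof.
by apply/ereal_infP => _ [a [a0 _] <-]; rewrite lee_fin ltW.
Qed.

(** Only positive levels compete in the infimum, so [alpha = 0] can be reached as a limit only;
    hence the condition on all levels above [alpha]. *)
Lemma rearrangement_le D f (t alpha : R) : 0 <= alpha ->
  (forall a : R, alpha < a -> (mu (D `&` [set x | (a < `|f x|)%R]) <= t%:E)%E) ->
  (rearrangement mu D f t <= alpha%:E)%E.
Proof.
move=> a0 H; apply/lee_addgt0Pr => e e0; apply: ereal_inf_lbound.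
exists (alpha + e) => //; split; first by rewrite ltr_wpDl.
by apply: H; rewrite ltrDl.
Qed.

Lemma rearrangement_ge D f (t v : R) :
  (forall a : R, 0 < a -> a < v -> (t%:E < mu (D `&` [set x | (a < `|f x|)%R]))%E) ->
  (v%:E <= rearrangement mu D f t)%E.
Proof.
move=> H; apply/ereal_infP => _ [a [a0 Ha] <-]; rewrite lee_fin leNgt.
by apply/negP => /(H a a0); rewrite ltNge Ha.
Qed.

Lemma lorentz_norm_ge0 D p r f : (0 <= lorentz_norm mu D p r f)%E.
Proof.
case: r => [r| |]//=; first exact: poweR_ge0.
apply: (@le_trans _ _ ((1 `^ p^-1)%:E * rearrangement mu D f 1)%E); last first.
  by apply: ereal_sup_ubound; exists 1 => //=; exact: ltr01.
by rewrite mule_ge0 ?rearrangement_ge0// lee_fin powR_ge0.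
Qed.

End lorentz_general.

(* The value at -oo is a filler. *)
Definition ellnorm {R : realType} (q : \bar R) (n : nat) (a : nat -> R) : R :=
  if q is q'%:E then (\sum_(j < n) `|a j| `^ q') `^ q'^-1
  else \big[Num.max/0]_(j < n) `|a j|.

Lemma le_ellnormy {R : realType} n (a : nat -> R) (j : 'I_n) :
  `|a j| <= ellnorm +oo%E n a.
Proof. by rewrite /=; exact: (le_bigmax _ (fun i : 'I_n => `|a i|) j). Qed.

Lemma ellnorm_ge0 {R : realType} q n (a : nat -> R) : 0 <= ellnorm q n a.
Proof.
case: q => [q||] /=; first exact: powR_ge0.
all: by apply: bigmax_ge_id.
Qed.

(* For a given t, all the cubes of side s_j with s_j^d <= t lie in the cube of
   volume t at the same corner, so the rearrangement at t only sees the others. *)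
Lemma lorentz_norm_upper {R : realType} d (p : R) (q : \bar R) (K : R) :
  (0 < d)%N -> 0 < p -> (0 < q)%E -> 0 < K ->
  exists2 C : R, 0 < C & forall (x0 : 'I_d -> R) (s : nat -> R) n (a : nat -> R)
    (D : set 'rV[R]_d) (f : 'rV[R]_d -> R),
  (forall j, 0 < s j) -> measurable D -> measurable_fun D f ->
  (forall x, D x -> f x = 0 \/ exists2 j : 'I_n,
      `|f x| <= K * `|a j| * (s j ^+ d) `^ (- p^-1) &
      obox x0 (fun i => x0 i + s j) x) ->
  (lorentz_norm (lebesgue_rV d) D p q f <= (C * ellnorm q n a)%:E)%E.
Proof.
move=> d0 p0 q0 K0.
have RU (x0 : 'I_d -> R) (s : nat -> R) n (a : nat -> R) (D : set 'rV[R]_d)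
    (f : 'rV[R]_d -> R) (t alpha : R) :
    (forall j, 0 < s j) -> measurable D -> measurable_fun D f ->
    (forall x, D x -> f x = 0 \/ exists2 j : 'I_n,
      `|f x| <= K * `|a j| * (s j ^+ d) `^ (- p^-1) &
      obox x0 (fun i => x0 i + s j) x) ->
    0 < t -> 0 <= alpha ->
    (forall j : 'I_n, t < s j ^+ d -> K * `|a j| * (s j ^+ d) `^ (- p^-1) <= alpha) ->
    (rearrangement (lebesgue_rV d) D f t <= alpha%:E)%E.
  move=> s0 mD mf Hf t0 a0 H; apply: rearrangement_le => // b ab.
  pose tau := t `^ (d%:R^-1).
  have tau0 : 0 < tau by exact: powR_gt0.
  have taud : tau ^+ d = t.
    by rewrite -powR_mulrn ?ltW// -powRrM mulVf ?powRr1 ?ltW// pnatr_eq0 -lt0n.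
  have E : lebesgue_rV d (obox x0 (fun i => x0 i + tau)) = t%:E.
    rewrite lebesgue_obox; last by move=> i; rewrite lerDl ltW.
    under eq_bigr do rewrite addrAC subrr add0r.
    by rewrite prodr_const card_ord taud.
  rewrite -E; apply: le_measure; rewrite ?inE.
  - rewrite (_ : D `&` _ = D `&` (Num.norm \o f) @^-1` `]b, +oo[).
      by apply: measurableT_comp => //; exact: measurable_itv.
    by apply/seteqP; split => x [Dx h]; split => //; move: h; rewrite /= in_itv/= andbT.
  - exact: measurable_obox.
  move=> x [Dx /= bf]; have [fx|[j fj xj]] := Hf x Dx.
    by have := le_lt_trans a0 (lt_trans ab bf); rewrite fx normr0 ltxx.
  have stau : s j <= tau.
    rewrite -(ler_pXn2r d0) ?nnegrE ?(ltW tau0) ?(ltW (s0 j))//.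
    rewrite taud leNgt; apply/negP => /H.
    move=> h; have := lt_trans (le_lt_trans (le_trans fj h) ab) bf.
    by rewrite ltxx.
  move=> i; have /andP[-> h] := xj i.
  by rewrite (lt_le_trans h)// lerD2l.
have sd0 (s : nat -> R) j : (forall j, 0 < s j) -> 0 < s j ^+ d.
  by move=> s0; rewrite exprn_gt0.
case: q q0 => [q| |]// q0.
- have {}q0 : 0 < q by rewrite -lte_fin.
  have b0 : 0 < q / p by rewrite divr_gt0.
  exists (((q / p)^-1) `^ q^-1 * K).
    by rewrite mulr_gt0// powR_gt0// invr_gt0.
  move=> x0 s n a D f s0 mD mf Hf; rewrite /lorentz_norm.
  pose u (j : nat) := K * `|a j| * (s j ^+ d) `^ (- p^-1).
  have u0 j : 0 <= u j by rewrite !mulr_ge0 ?powR_ge0// ltW.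
  pose sg j : set R := `]0, s j ^+ d[%classic.
  (* At [t] the rearrangement is at most the largest [u j] with [t < s j ^+ d]. Replacing this
     maximum by an l^q sum makes its q-th power additive, so that the integral splits over [j]
     without any loss growing with [n]. *)
  pose G (j : nat) (t : R) : R := u j `^ q * \1_(sg j) t.
  have G0 j t : 0 <= G j t by rewrite mulr_ge0 ?powR_ge0.
  have S0 (t : R) : 0 <= \sum_(j < n) G j t by apply: sumr_ge0.
  have R1 (t : R) : 0 < t ->
      (rearrangement (lebesgue_rV d) D f t <= ((\sum_(j < n) G j t) `^ q^-1)%R%:E)%E.
    move=> t0; apply: (RU x0 s n a) => //; first exact: powR_ge0.
    move=> j tj; rewrite -/(u j).
    have -> : u j = (u j `^ q) `^ q^-1 by rewrite -powRrM mulfV ?gt_eqF// powRr1.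
    apply: ge0_ler_powR; rewrite ?nnegrE ?powR_ge0 ?invr_ge0 ?(ltW q0)//.
    rewrite (bigD1 j)//= {1}/G indicE mem_set ?mulr1; last by rewrite /sg/= in_itv/= t0.
    by rewrite lerDl sumr_ge0.
  have R2 (t : R) : 0 < t ->
      (rearrangement (lebesgue_rV d) D f t `^ q <= (\sum_(j < n) G j t)%R%:E)%E.
    move=> t0; have -> : \sum_(j < n) G j t = ((\sum_(j < n) G j t) `^ q^-1) `^ q.
      by rewrite -powRrM mulVf ?gt_eqF// powRr1.
    rewrite -poweR_EFin; apply: gt0_ler_poweR; rewrite ?in_itv/= ?leey ?andbT ?(ltW q0)//.
    - exact: rearrangement_ge0.
    - by rewrite lee_fin powR_ge0.
    - exact: R1.
  have I1 : (\int[@lebesgue_measure R]_(t in `]0%R, +oo[)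
     ((t `^ (q / p - 1))%R%:E * rearrangement (lebesgue_rV d) D f t `^ q) <=
     \sum_(j < n) (u j `^ q * ((q / p)^-1 * (s j ^+ d) `^ (q / p)))%R%:E)%E.
    apply: (@le_trans _ _ (\int[@lebesgue_measure R]_(t in `]0%R, +oo[)
        (\sum_(j < n) ((u j `^ q)%:E * (t `^ (q / p - 1) * \1_(sg j) t)%R%:E)))%E).
      apply: le_integral_nonneg => t; rewrite /= in_itv/= andbT => t0.
      rewrite mule_ge0 ?poweR_ge0 ?lee_fin ?powR_ge0//=.
      apply: (@le_trans _ _ ((t `^ (q / p - 1))%R%:E * (\sum_(j < n) G j t)%R%:E)%E).
        by apply: lee_pmul; rewrite ?poweR_ge0 ?lee_fin ?powR_ge0//; exact: R2.
      rewrite -EFinM mulr_sumr -sumEFin lee_sum// => j _.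
      by rewrite -EFinM lee_fin /G mulrCA.
    have mg j : measurable_fun (`]0, +oo[%classic : set R)
        (fun t : R => (t `^ (q / p - 1) * \1_(sg j) t)%R%:E).
      apply/measurable_EFinP/measurable_funM.
        by apply: measurable_funTS; exact: measurable_powR.
      by apply: measurable_indic; exact: measurable_itv.
    have g0 j t : (0 <= (t `^ (q / p - 1) * \1_(sg j) t)%R%:E :> \bar R)%E.
      by rewrite lee_fin mulr_ge0 ?powR_ge0.
    rewrite ge0_integral_sum//; last 2 first.
    - by move=> j; apply: measurable_funeM; exact: mg.
    - by move=> j t _; rewrite mule_ge0 ?g0// lee_fin powR_ge0.
    apply: lee_sum => j _; rewrite ge0_integralZl ?lee_fin ?powR_ge0//; last first.
      exact: mg.
    rewrite EFinM; apply: lee_wpmul2l; first by rewrite lee_fin powR_ge0.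
    apply: le_trans (integral_powR_itvoo b0 (sd0 s j s0)).
    rewrite [leRHS]integral_mkcond [leLHS]integral_mkcond.
    apply: le_integral_nonneg => t _; rewrite !patchE -/(sg j) -![point]/(0%E : \bar R).
    case: ifPn => t0; last first.
      by rewrite lexx/=; case: ifPn => // _; rewrite lee_fin powR_ge0.
    by rewrite g0 indicE; case: ifPn => h; rewrite ?mulr1 ?mulr0 lexx.
  have E1 : (\sum_(j < n) (u j `^ q * ((q / p)^-1 * (s j ^+ d) `^ (q / p)))%R%:E =
      ((q / p)^-1 * K `^ q * \sum_(j < n) `|a j| `^ q)%R%:E)%E.
    rewrite sumEFin; congr EFin; rewrite mulr_sumr; apply: eq_bigr => j _.
    rewrite /u powRM ?mulr_ge0 ?powR_ge0 ?(ltW K0)// powRM ?(ltW K0)//.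
    have -> : ((s j ^+ d) `^ (- p^-1)) `^ q = ((s j ^+ d) `^ (q / p))^-1.
      by rewrite -powRrM -powRN; congr (_ `^ _); rewrite mulrC mulrN.
    have : (s j ^+ d) `^ (q / p) != 0 by rewrite gt_eqF// powR_gt0// sd0.
    by move: (q / p)^-1 => X h; field.
  rewrite E1 in I1.
  have := gt0_ler_poweR (_ : 0 <= q^-1) _ _ I1.
  rewrite !in_itv/= !leey !andbT invr_ge0 (ltW q0) => /(_ isT) H.
  apply: (le_trans (H _ _)).
  - by apply: integral_ge0 => t _; rewrite mule_ge0 ?poweR_ge0 ?lee_fin ?powR_ge0.
  - by rewrite lee_fin !mulr_ge0 ?powR_ge0 ?invr_ge0 ?(ltW b0)// sumr_ge0// => j _;
      exact: powR_ge0.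
  rewrite lee_fin powRM; last 2 first.
  - by rewrite mulr_ge0 ?powR_ge0// invr_ge0 ltW.
  - by rewrite sumr_ge0// => j _; exact: powR_ge0.
  rewrite powRM ?powR_ge0 ?invr_ge0 ?(ltW b0)//.
  by rewrite -[in X in X <= _]powRrM mulfV ?gt_eqF// powRr1 ?(ltW K0).
- exists K => // x0 s n a D f s0 mD mf Hf; rewrite /lorentz_norm.
  apply: ge_ereal_sup => _ [t /= t0 <-].
  have N0 := @ellnorm_ge0 R +oo%E n a.
  (* For [t < s j ^+ d] the j-th height is at most K |a_j| t^(-1/p), and the factor t^(1/p) of the
     weak norm removes the dependence on [t]. *)
  apply: (@le_trans _ _ ((t `^ p^-1)%:E * (K * ellnorm +oo%E n a * t `^ (- p^-1))%:E)%E).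
    apply: lee_wpmul2l; first by rewrite lee_fin powR_ge0.
    apply: (RU x0 s n a) => //; first by rewrite !mulr_ge0 ?powR_ge0 ?(ltW K0).
    move=> j tj; rewrite ler_pM ?mulr_ge0 ?powR_ge0 ?(ltW K0)//.
      by rewrite ler_wpM2l ?(ltW K0)//; exact: le_ellnormy.
    rewrite !powRN lef_pV2 ?posrE ?powR_gt0 ?sd0//.
    apply: ge0_ler_powR; rewrite ?nnegrE ?invr_ge0 ?(ltW p0) ?(ltW t0) ?(ltW tj)//.
    by rewrite ltW// sd0.
  rewrite -EFinM lee_fin mulrCA powRN mulfV ?mulr1//.
  by rewrite gt_eqF// powR_gt0.
Qed.

Lemma ellnormy_attained {R : realType} n (a : nat -> R) :
  ellnorm +oo%E n a = 0 \/ exists j : 'I_n, ellnorm +oo%E n a = `|a j|.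
Proof.
rewrite /=; apply: (big_ind (fun x => x = 0 \/ exists j : 'I_n, x = `|a j|)).
- by left.
- by move=> x y hx hy; rewrite /Order.max; case: ifP.
- by move=> j _; right; exists j.
Qed.

(* The intervals ]s0 theta^(j+1), s0 theta^j[ are disjoint, and on the j-th one
   the rearrangement is at least the j-th height. *)
Lemma lorentz_norm_lower {R : realType} {dp} {T : measurableType dp}
    (mu : {measure set T -> \bar R}) (p : R) (q : \bar R) (delta theta : R) :
  0 < p -> (0 < q)%E -> 0 < delta -> 0 < theta -> theta < 1 ->
  exists2 c : R, 0 < c & forall (s0 : R) n (a : nat -> R)
    (D : set T) (f : T -> R), 0 < s0 ->
  (forall (j : 'I_n) (alpha : R), 0 < alpha ->
      alpha < delta * `|a j| * (s0 * theta ^+ j) `^ (- p^-1) ->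
      ((s0 * theta ^+ j)%:E <= mu (D `&` [set x | (alpha < `|f x|)%R]))%E) ->
  ((c * ellnorm q n a)%:E <= lorentz_norm mu D p q f)%E.
Proof.
move=> p0 q0 de0 th0 th1.
have RL s0 n (a : nat -> R) (D : set T) (f : T -> R) :
    (forall (j : 'I_n) (alpha : R), 0 < alpha ->
      alpha < delta * `|a j| * (s0 * theta ^+ j) `^ (- p^-1) ->
      ((s0 * theta ^+ j)%:E <= mu (D `&` [set x | (alpha < `|f x|)%R]))%E) ->
    forall (j : 'I_n) (t : R), t < s0 * theta ^+ j ->
    ((delta * `|a j| * (s0 * theta ^+ j) `^ (- p^-1))%:E <= rearrangement mu D f t)%E.
  move=> H j t tj; apply: rearrangement_ge => al al0 alv.
  by apply: lt_le_trans (H j al al0 alv); rewrite lte_fin.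
case: q q0 => [q| |]// q0.
- have {}q0 : 0 < q by rewrite -lte_fin.
  have b0 : 0 < q / p by rewrite divr_gt0.
  pose c0 := theta `^ (q / p) * (1 - theta).
  have c00 : 0 < c0 by rewrite mulr_gt0 ?powR_gt0 ?subr_gt0.
  exists (delta * c0 `^ q^-1); first by rewrite mulr_gt0 ?powR_gt0.
  move=> s0 n a D f s00 Hf; rewrite /lorentz_norm.
  pose s j := s0 * theta ^+ j.
  have sj0 j : 0 < s j by rewrite mulr_gt0 ?exprn_gt0.
  have snd i j : (i <= j)%N -> s j <= s i.
    by move=> ij; rewrite ler_wpM2l ?(ltW s00)// ler_wiXn2l// ltW.
  pose v j := delta * `|a j| * s j `^ (- p^-1).
  have v0 j : 0 <= v j by rewrite !mulr_ge0 ?powR_ge0// ltW.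
  pose J j : set R := `]s j.+1, s j[%classic.
  have mJ j : measurable (J j) by exact: measurable_itv.
  (* A constant lower bound of the integrand on [J j]. As q/p - 1 may have either sign, t^(q/p - 1)
     is split into t^(q/p), estimated at the left end [theta * s j], and 1/t, estimated at the right
     end. *)
  pose w j := (theta * s j) `^ (q / p) / s j * v j `^ q.
  have w0 j : 0 <= w j by rewrite !mulr_ge0 ?powR_ge0// invr_ge0 ltW.
  pose X (t : R) : \bar R := ((t `^ (q / p - 1))%R%:E * rearrangement mu D f t `^ q)%E.
  have X0 t : (0 <= X t)%E by rewrite mule_ge0 ?poweR_ge0 ?lee_fin ?powR_ge0.
  have JX (j : 'I_n) t : J j t -> ((w j)%:E <= X t)%E.
    rewrite /J/= in_itv/= => /andP[h1 h2].
    have t0 : 0 < t by exact: lt_trans h1.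
    rewrite /w EFinM; apply: lee_pmul.
    - by rewrite lee_fin mulr_ge0 ?powR_ge0// invr_ge0 ltW.
    - by rewrite lee_fin powR_ge0.
    - rewrite lee_fin powRB ?(gt_eqF t0) ?implybT// powRr1 ?(ltW t0)//.
      apply: ler_pM; rewrite ?powR_ge0 ?invr_ge0 ?(ltW (sj0 _))//.
        apply: ge0_ler_powR; rewrite ?nnegrE ?(ltW b0) ?(ltW t0)//.
          by rewrite mulr_ge0// ltW.
        by move: h1; rewrite /s exprS mulrCA => /ltW.
      by rewrite lef_pV2 ?posrE// ltW.
    - rewrite -poweR_EFin; apply: gt0_ler_poweR; rewrite ?in_itv/= ?leey ?andbT ?(ltW q0)//.
      + by rewrite lee_fin.
      + exact: rearrangement_ge0.
      + exact: RL.
  have I1 : (\sum_(j < n) (w j * ((1 - theta) * s j))%R%:E <=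
      \int[@lebesgue_measure R]_(t in `]0%R, +oo[) X t)%E.
    apply: (@le_trans _ _ (\int[@lebesgue_measure R]_(t in `]0%R, +oo[)
        (\sum_(j < n) ((w j)%:E * (\1_(J j) t)%:E)))%E).
      rewrite ge0_integral_sum//=; last 2 first.
      - move=> j; apply: measurable_funeM; apply/measurable_EFinP.
        by apply: measurable_indic; exact: mJ.
      - by move=> j t _; rewrite mule_ge0 ?lee_fin.
      apply: lee_sum => j _.
      rewrite ge0_integralZl ?lee_fin//; last first.
        by apply/measurable_EFinP; apply: measurable_indic; exact: mJ.
      rewrite EFinM; apply: lee_wpmul2l; first by rewrite lee_fin.
      rewrite integral_indic//; last exact: mJ.
      have JI : J j `<=` `]0, +oo[%classic.
        by move=> t; rewrite /J/= !in_itv/= andbT => /andP[/(lt_trans (sj0 _))].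
      rewrite (setIidl JI) [leRHS](lebesgue_measure_itv `]s j.+1, s j[)/= lte_fin.
      have lts : s j.+1 < s j by rewrite /s exprS mulrCA gtr_pMl// sj0.
      by rewrite lts -EFinB lee_fin mulrBl mul1r /s exprS mulrCA.
    apply: le_integral_nonneg => t _; rewrite sume_ge0/=; last first.
      by move=> j _; rewrite mule_ge0 ?lee_fin.
    have [[j Jj]|nJ] := pselect (exists j : 'I_n, J j t); last first.
      rewrite big1 ?X0// => j _; rewrite indicE memNset ?mule0// => Jj.
      by apply: nJ; exists j.
    rewrite (bigD1 j)//= indicE mem_set// mule1 big1 ?adde0 ?JX// => i ij.
    rewrite indicE memNset ?mule0// /J/= in_itv/= => /andP[i1 i2].
    move: Jj; rewrite /J/= in_itv/= => /andP[j1 j2].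
    move: ij; rewrite -val_eqE/= neq_ltn => /orP[/snd|/snd] h.
      by have := lt_trans (lt_le_trans j2 h) i1; rewrite ltxx.
    by have := lt_trans (lt_le_trans i2 h) j1; rewrite ltxx.
  have E1 : (\sum_(j < n) (w j * ((1 - theta) * s j))%R%:E =
     (delta `^ q * c0 * \sum_(j < n) `|a j| `^ q)%R%:E)%E.
    rewrite sumEFin; congr EFin; rewrite mulr_sumr; apply: eq_bigr => j _.
    have Es : (s j `^ (- p^-1)) `^ q = (s j `^ (q / p))^-1.
      by rewrite -powRrM -powRN; congr (_ `^ _); rewrite mulrC mulrN.
    have Ev : v j `^ q = delta `^ q * `|a j| `^ q * (s j `^ (q / p))^-1.
      rewrite /v powRM ?mulr_ge0 ?powR_ge0 ?(ltW de0)// Es.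
      by rewrite powRM ?(ltW de0).
    rewrite /w Ev (powRM _ (ltW th0) (ltW (sj0 _))).
    have h1 : s j `^ (q / p) != 0 by rewrite gt_eqF// powR_gt0.
    have h2 : s j != 0 by rewrite gt_eqF.
    by rewrite /c0; field; rewrite h1 h2.
  rewrite E1 in I1.
  have := gt0_ler_poweR (_ : 0 <= q^-1) _ _ I1.
  rewrite !in_itv/= !leey !andbT invr_ge0 (ltW q0) => /(_ isT) H.
  apply: le_trans (H _ _).
  - rewrite lee_fin powRM; last 2 first.
    + by rewrite mulr_ge0 ?powR_ge0// ltW.
    + by rewrite sumr_ge0// => j _; exact: powR_ge0.
    rewrite powRM ?powR_ge0 ?(ltW c00)//.
    by rewrite -[in X in _ <= X]powRrM mulfV ?gt_eqF// powRr1 ?(ltW de0).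
  - rewrite lee_fin; apply: mulr_ge0; last by apply: sumr_ge0 => j _; exact: powR_ge0.
    by apply: mulr_ge0; [exact: powR_ge0|exact: ltW].
  - by apply: integral_ge0 => t _; exact: X0.
- exists (delta * 2^-1 `^ p^-1); first by rewrite mulr_gt0 ?powR_gt0.
  move=> s0 n a D f s00 Hf.
  have [->|[j ->]] := ellnormy_attained n a.
    by rewrite mulr0; exact: lorentz_norm_ge0.
  have sj0 : 0 < s0 * theta ^+ j by rewrite mulr_gt0 ?exprn_gt0.
  (* The height bound needs [t] strictly below s_j; taking half of it costs the factor 2^(-1/p) in
     the constant. *)
  pose t := s0 * theta ^+ j / 2.
  have t0 : 0 < t by rewrite divr_gt0.
  have tj : t < s0 * theta ^+ j by rewrite ltr_pdivrMr// ltr_pMr// ltr1n.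
  apply: (@le_trans _ _ ((t `^ p^-1)%:E * rearrangement mu D f t)%E); last first.
    by apply: ereal_sup_ubound; exists t.
  apply: (@le_trans _ _ ((t `^ p^-1)%:E *
      (delta * `|a j| * (s0 * theta ^+ j) `^ (- p^-1))%:E)%E).
    rewrite -EFinM lee_fin /t powRM ?(ltW sj0)// powRN.
    have h : (s0 * theta ^+ j) `^ p^-1 != 0 by rewrite gt_eqF// powR_gt0.
    rewrite le_eqVlt; apply/orP; left; apply/eqP; field.
    exact: h.
  by apply: lee_wpmul2l; [rewrite lee_fin powR_ge0|exact: RL].
Qed.

(** The tangent at 1 lies above the concave power function; this is Young's inequality for y^theta
    and 1 with the exponents 1/theta and 1/(1 - theta). *)
Lemma powR_concave_le {R : realType} (theta y : R) :
  0 < theta -> theta <= 1 -> 0 <= y -> y `^ theta <= 1 - theta + theta * y.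
Proof.
move=> t0; rewrite le_eqVlt => /predU1P[->|t1] y0.
  by rewrite powRr1// subrr add0r mul1r.
have := @conjugate_powR R (y `^ theta) 1 theta^-1 (1 - theta)^-1.
rewrite powR_ge0 ler01 !invr_gt0 subr_gt0 t0 t1 !invrK.
move=> /(_ isT isT isT isT); rewrite addrCA subrr addr0 => /(_ erefl).
by rewrite mulr1 -powRrM mulfV ?gt_eqF// powRr1// powR1 mul1r addrC [y * _]mulrC.
Qed.

Lemma fine_inve {R : realType} (x : R) : x != 0 -> fine (x%:E)^-1 = x^-1.
Proof. by move=> x0; rewrite inver (negbTE x0). Qed.

(** Hölder's inequality for finite sums. For finite [r] the tangent bound for y^(q/r) is summed over
    y = |a_j|^r / B, with B the mean of the |a_j|^r, so that its right-hand sides add up to [n]. The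
    case of vanishing B is separate. For infinite [r], the inverse of [r] is 0. *)
Lemma ellnorm_le {R : realType} (q r : \bar R) n (a : nat -> R) :
  (0 < q)%E -> (q <= r)%E -> (0 < n)%N ->
  ellnorm q n a <= n%:R `^ (fine q^-1 - fine r^-1) * ellnorm r n a.
Proof.
move=> q0 qr n0; have N0 : 0 < n%:R :> R by rewrite ltr0n.
case: q q0 qr => [q| |]// q0; last first.
  by rewrite leye_eq => /eqP ->; rewrite subrr powRr0 mul1r.
have {}q0 : 0 < q by rewrite -lte_fin.
rewrite fine_inve ?gt_eqF//.
case: r => [r| |]//.
  rewrite lee_fin => qr; have r0 := lt_le_trans q0 qr.
  rewrite fine_inve ?gt_eqF//=.
  set S := \sum_(j < n) `|a j| `^ r.
  have S0 : 0 <= S by apply: sumr_ge0 => j _; exact: powR_ge0.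
  move: S0; rewrite le_eqVlt => /predU1P[/esym S0|S0].
    rewrite big1 ?powR0 ?invr_neq0 ?gt_eqF// ?mulr_ge0 ?powR_ge0// => j _.
    have /eqP := S0; rewrite psumr_eq0; last by move=> i _; exact: powR_ge0.
    move=> /allP /(_ j (mem_index_enum _))/= /eqP /powR_eq0_eq0 ->.
    by rewrite powR0 ?gt_eqF.
  pose B := S / n%:R; have B0 : 0 < B by rewrite divr_gt0.
  have th0 : 0 < q / r by rewrite divr_gt0.
  have H : \sum_(j < n) `|a j| `^ q <= n%:R * B `^ (q / r).
    rewrite -ler_pdivrMr ?powR_gt0// mulr_suml.
    have -> : n%:R = \sum_(j < n) (1 - q / r + q / r * (`|a j| `^ r / B)).
      rewrite big_split/= sumr_const card_ord -mulr_sumr -mulr_suml -/S.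
      by rewrite -[_ *+ n]mulr_natr /B; field; rewrite !gt_eqF.
    apply: ler_sum => j _.
    apply: le_trans (powR_concave_le th0 _ _); last 2 first.
    - by rewrite ler_pdivrMr// mul1r.
    - by rewrite divr_ge0 ?powR_ge0// ltW.
    rewrite powRM ?powR_ge0 ?invr_ge0 ?(ltW B0)//.
    rewrite -powRrM mulrCA mulfV ?gt_eqF// mulr1.
    by rewrite -[B^-1]powR_inv1 ?(ltW B0)// -powRrM mulN1r powRN.
  apply: (@le_trans _ _ ((n%:R * B `^ (q / r)) `^ q^-1)).
    apply: ge0_ler_powR; rewrite ?nnegrE ?invr_ge0 ?(ltW q0)//.
    - by apply: sumr_ge0 => j _; exact: powR_ge0.
    - by rewrite mulr_ge0 ?powR_ge0// ltW.
  rewrite powRM ?powR_ge0 ?(ltW N0)// -powRrM mulrAC mulfV ?gt_eqF// mul1r.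
  rewrite /B powRM ?(ltW S0) ?invr_ge0 ?(ltW N0)//.
  rewrite powRB ?(gt_eqF N0) ?implybT//.
  rewrite -[n%:R^-1]powR_inv1 ?(ltW N0)// -powRrM mulN1r powRN.
  by rewrite -[leRHS]mulrA [X in _ <= _ * X]mulrC.
move=> _; set X := ellnorm +oo%E n a; rewrite invey subr0.
have X0 : 0 <= X by exact: ellnorm_ge0.
rewrite /ellnorm.
have -> : X = (X `^ q) `^ q^-1 by rewrite -powRrM mulfV ?gt_eqF// powRr1.
rewrite -powRM ?powR_ge0 ?(ltW N0)//.
apply: ge0_ler_powR; rewrite ?nnegrE ?invr_ge0 ?(ltW q0)//.
- by apply: sumr_ge0 => j _; exact: powR_ge0.
- by rewrite mulr_ge0 ?powR_ge0// ltW.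
rewrite mulrC -[X in _ * X%:R](card_ord n) mulr_natr -sumr_const.
apply: ler_sum => j _; apply: ge0_ler_powR; rewrite ?nnegrE ?(ltW q0)//.
exact: (@le_ellnormy R n a).
Qed.

(** * The dilated bumps *)

Section lacunary.
Context {R : realType} {d : nat}.
Variables (m : nat) (p : R) (y : 'I_d -> R) (rho : R).
Hypotheses (d0 : (0 < d)%N) (rho0 : 0 < rho) (rho1 : rho <= 1).

Definition scale (j : nat) : R := rho / 2 * 2^-1 ^+ j.

(* A profile supported inside ]1, 2[ makes the supports at distinct dyadic scales
   disjoint. *)
Definition profile : R -> R := bump (5 / 4) (7 / 4) 1.

Definition wave (j : nat) : ('I_d -> nat) -> 'rV[R]_d -> R :=
  tensor (fun i s => profile ((scale j)^-1 * s + - (y i / scale j))).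

Definition weight (j : nat) : R := scale j `^ (m%:R - d%:R / p).

(** Coefficients are sequences on [nat], so that combinations of different lengths can be padded to
    a common one. *)
Definition comb (n : nat) (a : nat -> R) (beta : 'I_d -> nat) (x : 'rV[R]_d) : R :=
  \sum_(j < n) (a j * weight j) * wave j beta x.

Lemma scale_gt0 j : 0 < scale j.
Proof. by rewrite mulr_gt0 ?divr_gt0// exprn_gt0. Qed.

Lemma scale_lt j k : (j < k)%N -> 2 * scale k <= scale j.
Proof.
move=> jk; rewrite /scale mulrCA ler_wpM2l ?divr_ge0 ?(ltW rho0)//.
rewrite -(subnKC jk) addSn exprS mulrA divff ?mul1r ?pnatr_eq0//.
by rewrite ler_wiXn2l ?invr_ge0// ?invf_le1 ?ler1n// leq_addr.
Qed.

Lemma scale_le_rho j : 2 * scale j <= rho.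
Proof.
rewrite /scale mulrA mulrCA divff ?pnatr_eq0// mulr1 ler_piMr ?(ltW rho0)//.
by rewrite exprn_ile1 ?invr_ge0// invf_le1 ?ler1n.
Qed.

Lemma scale_le1 j : scale j <= 1.
Proof. by have := scale_le_rho j; have := scale_gt0 j; move: rho1; lra. Qed.

Lemma smooth1_profile : smooth1 profile.
Proof. exact: smooth1_bump. Qed.

Lemma wave_family j : derivative_family (wave j).
Proof. by apply: tensor_family => i; apply: smooth1_affine; exact: smooth1_profile. Qed.

Lemma comb_family n a : derivative_family (comb n a).
Proof. by apply: (family_sum n (fun j => a j * weight j)) => j; exact: wave_family. Qed.

Lemma waveE j beta x : wave j beta x = (scale j)^-1 ^+ (\sum_i beta i)%N *
  \prod_i derive1n (beta i) profile ((x ord0 i - y i) / scale j).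
Proof.
rewrite -prodrXr -big_split/=; apply: eq_bigr => i _.
rewrite derive1n_affine; last exact: smooth1_profile.
rewrite (_ : (x ord0 i - y i) / scale j =
  (scale j)^-1 * x ord0 i + - (y i / scale j))//.
by rewrite mulrBl mulrC.
Qed.

Lemma wave_supp j beta x : wave j beta x != 0 ->
  forall i, scale j < x ord0 i - y i < 2 * scale j.
Proof.
rewrite waveE mulf_eq0 negb_or => /andP[_] /prodf_neq0 h i.
have := h i isT; apply: contra_neqT => nx.
apply: derive1n_bump_eq0 => //; apply: contra nx => /andP[].
rewrite ler_pdivlMr ?scale_gt0// ler_pdivrMr ?scale_gt0//.
by have := scale_gt0 j => ? ? ?; apply/andP; split; lra.
Qed.

Lemma wave_disjoint j k beta x :
  wave j beta x != 0 -> wave k beta x != 0 -> j = k.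
Proof.
move=> /wave_supp /(_ (Ordinal d0)) /andP[j1 j2].
move=> /wave_supp /(_ (Ordinal d0)) /andP[k1 k2].
by case: (ltngtP j k) => // /scale_lt h; exfalso; lra.
Qed.

Lemma combE n a (j : 'I_n) beta x : wave j beta x != 0 ->
  comb n a beta x = a j * weight j * wave j beta x.
Proof.
move=> wj; rewrite /comb (bigD1 j)//= big1 ?addr0// => k kj.
have [->|wk] := eqVneq (wave k beta x) 0; first by rewrite mulr0.
by have := wave_disjoint wk wj => /val_inj kj'; rewrite kj' eqxx in kj.
Qed.

Lemma comb_eq0 n a beta x : (forall j : 'I_n, wave j beta x = 0) ->
  comb n a beta x = 0.
Proof. by move=> w0; rewrite /comb big1// => j _; rewrite w0 mulr0. Qed.

Lemma comb_supp n a beta x : comb n a beta x != 0 ->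
  forall i, y i < x ord0 i < y i + rho.
Proof.
move=> c0; have [j /eqP wj] : exists j : 'I_n, wave j beta x <> 0.
  apply/not_existsP => H; move/eqP: c0; apply.
  by apply: comb_eq0 => j; apply: contrapT; exact: H.
move=> i; have /andP[h1 h2] := wave_supp wj i.
have := scale_gt0 j; have := scale_le_rho j => h3 h4.
by apply/andP; split; lra.
Qed.

Lemma test_function_comb Omega n a : cbox y (fun i => y i + rho) `<=` Omega ->
  test_function Omega (comb n a (fun=> 0%N)).
Proof.
move=> yO; apply: test_function_supp yO _; first exact: smooth_family (comb_family _ _).
move=> x nx; apply/eqP/negPn/negP => /comb_supp h; apply: nx => i.
by have /andP[/ltW -> /ltW ->] := h i.
Qed.

End lacunary.

Lemma profile_bounded {R : realType} m :
  exists2 M : R, 0 < M & forall k x, (k <= m)%N -> `|derive1n k (@profile R) x| <= M.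
Proof.
elim: m => [|m [M M0 hM]].
  have [M M0 hM] := @derive1n_bump_bounded R (5 / 4) (7 / 4) 1 0 ltr01.
  by exists M => // k x; rewrite leqn0 => /eqP ->; exact: hM.
have [N N0 hN] := @derive1n_bump_bounded R (5 / 4) (7 / 4) 1 m.+1 ltr01.
exists (M + N) => [|k x]; first exact: addr_gt0.
rewrite leq_eqVlt => /predU1P[->|km].
  by rewrite (le_trans (hN x))// lerDr ltW.
by rewrite (le_trans (hM k x km))// lerDl ltW.
Qed.

Lemma powR_exprn {R : realType} (x e : R) n : 0 <= x -> (x ^+ n) `^ e = x `^ (n%:R * e).
Proof. by move=> x0; rewrite powRrM powR_mulrn. Qed.

Lemma weight_scale {R : realType} d m (p rho : R) j n : 0 < rho ->
  @weight R d m p rho j * (scale rho j)^-1 ^+ n =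
  scale rho j `^ (m%:R - d%:R / p - n%:R).
Proof.
move=> rho0; have s0 := scale_gt0 rho0 j.
rewrite exprVn -powR_mulrn ?(ltW s0)// /weight [RHS]powRB//.
by rewrite (gt_eqF s0) implybT.
Qed.

(** The condition on exponents compares the height scale^(m - d/p - |beta|) with the critical
    scale^(- d/p'), using [scale rho j <= 1]. It is an equality for p' = p at order m, and for p'
    the Sobolev exponent at order 0. *)
Lemma comb_upper {R : realType} d m (p : R) (y : 'I_d -> R) rho (p' : R) (q : \bar R) :
  (0 < d)%N -> 0 < rho -> rho <= 1 -> 0 < p' -> (0 < q)%E ->
  exists2 C : R, 0 < C & forall n a beta (Omega : set 'rV[R]_d),
    measurable Omega -> (\sum_i beta i <= m)%N ->
    - (d%:R / p') <= m%:R - d%:R / p - (\sum_i beta i)%:R ->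
  (lorentz_norm (lebesgue_rV d) Omega p' q (comb m p y rho n a beta) <=
   (C * ellnorm q n a)%:E)%E.
Proof.
move=> d0 rho0 rho1 p0 q0; have [M M0 hM] := @profile_bounded R m.
(* One factor [M] for each coordinate; the power of 2 appears because the j-th support lies in the
   cube of side [2 * scale rho j] at the corner [y]. *)
have K0 : 0 < M ^+ d * 2 `^ (d%:R / p') by rewrite mulr_gt0 ?exprn_gt0 ?powR_gt0.
have [C C0 hC] := lorentz_norm_upper d0 p0 q0 K0.
exists C => // n a beta Omega mO betam expo.
apply: (hC y (fun j => 2 * scale rho j)) => //.
- by move=> j; rewrite mulr_gt0// scale_gt0.
- apply: measurable_funTS; apply: continuous_measurable_rV.
  exact: (comb_family m p y rho n a beta).1.
move=> x _.
have [[j wj]|nw] := pselect (exists j : 'I_n, wave y rho j beta x != 0); last first.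
  left; apply: comb_eq0 => j; apply/eqP/negPn/negP => wj; apply: nw; by exists j.
right; exists j; last first.
  move=> i; have /andP[h1 h2] := wave_supp rho0 wj i.
  by have := scale_gt0 rho0 j => h3; apply/andP; split; lra.
have s0 := scale_gt0 rho0 j.
have E : comb m p y rho n a beta x = a j *
    (scale rho j `^ (m%:R - d%:R / p - (\sum_i beta i)%:R) *
    \prod_i derive1n (beta i) profile ((x ord0 i - y i) / scale rho j)).
  by rewrite (combE m p d0 rho0 a wj) waveE -weight_scale// !mulrA.
rewrite E normrM [`|_ * \prod_(_ | _) _|]normrM (ger0_norm (powR_ge0 _ _)) normr_prod.
have s20 : 0 <= 2 * scale rho j by apply: mulr_ge0 => //; exact: ltW.
rewrite powR_exprn// powRM ?(ltW s0)//.
have -> : M ^+ d * 2 `^ (d%:R / p') * `|a j| *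
    (2 `^ (d%:R * - p'^-1) * scale rho j `^ (d%:R * - p'^-1)) =
    `|a j| * (scale rho j `^ (- (d%:R / p')) * M ^+ d).
  rewrite mulrN powRN; have h : (2 : R) `^ (d%:R / p') != 0 by rewrite gt_eqF// powR_gt0.
  by field.
rewrite ler_wpM2l// ler_pM ?powR_ge0//.
- by apply: prodr_ge0 => i _.
- by apply: ger_powR; rewrite // s0 scale_le1.
rewrite (_ : M ^+ d = \prod_(i < d) M); last by rewrite prodr_const card_ord.
apply: ler_prod => i _.
rewrite normr_ge0 hM// (leq_trans _ betam)//.
by rewrite (bigD1 i)//= leq_addr.
Qed.

(** Stated for any [g] equal almost everywhere to the derivative, since the Sobolev quasi-norm
    ranges over all versions. *)
Lemma comb_lower {R : realType} d m (p : R) (y : 'I_d -> R) rho (p' : R) (q : \bar R) beta :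
  (0 < d)%N -> 0 < rho -> 0 < p' -> (0 < q)%E ->
  - (d%:R / p') = m%:R - d%:R / p - (\sum_i beta i)%:R ->
  exists2 c : R, 0 < c & forall n a (Omega : set 'rV[R]_d) (g : 'rV[R]_d -> R),
    measurable Omega -> measurable_fun Omega g ->
    cbox y (fun i => y i + rho) `<=` Omega ->
    ae_eq (lebesgue_rV d) (obox y (fun i => y i + rho)) (EFin \o g)
      (EFin \o comb m p y rho n a beta) ->
  ((c * ellnorm q n a)%:E <= lorentz_norm (lebesgue_rV d) Omega p' q g)%E.
Proof.
move=> d0 rho0 p0 q0 expo.
have /choice[del hdel] : forall i : 'I_d, exists t : R * R * R,
    [/\ 0 < t.1.1, t.1.2 < t.2 & forall x, t.1.2 < x < t.2 ->
      t.1.1 < `|derive1n (beta i) (@profile R) x|].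
  move=> i; have [de [u [v [h1 h2 h3]]]] :=
    @derive1n_bump_lb R (5 / 4) (7 / 4) 1 (beta i) ltr01 (ltac:(lra)).
  by exists (de, u, v).
pose Delta := \prod_i (del i).1.1; pose kappa := \prod_i ((del i).2 - (del i).1.2).
have D0 : 0 < Delta by apply: prodr_gt0 => i _; have [] := hdel i.
have k0 : 0 < kappa by apply: prodr_gt0 => i _; rewrite subr_gt0; have [] := hdel i.
have th0 : 0 < (2^-1 : R) ^+ d by rewrite exprn_gt0.
have th1 : (2^-1 : R) ^+ d < 1.
  by rewrite exprn_ilt1 ?invr_ge0 ?invf_lt1 ?ltr1n// -lt0n.
(* The level set found at scale j has measure at least [kappa * scale rho j ^+ d]; the factor
   kappa^(1/p') offsets the power of [kappa] that this measure brings into the height. *)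
have dk0 : 0 < Delta * kappa `^ p'^-1 by rewrite mulr_gt0 ?powR_gt0.
have [c c0 hc] := lorentz_norm_lower (lebesgue_rV d) p0 q0 dk0 th0 th1.
exists c => // n a Omega g mO mg yO aeg.
have sE j : kappa * (rho / 2) ^+ d * (2^-1 ^+ d) ^+ j = kappa * scale rho j ^+ d.
  by rewrite -mulrA exprAC -exprMn.
apply: (hc (kappa * (rho / 2) ^+ d)) => [|j al al0].
  by rewrite mulr_gt0 ?exprn_gt0 ?divr_gt0.
rewrite sE; have s0 := scale_gt0 rho0 j.
have -> : Delta * kappa `^ p'^-1 * `|a j| * (kappa * scale rho j ^+ d) `^ (- p'^-1) =
    `|a j| * (scale rho j `^ (- (d%:R / p')) * Delta).
  rewrite powRM ?exprn_ge0 ?(ltW k0) ?(ltW s0)// powR_exprn ?(ltW s0)// mulrN powRN.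
  have h : kappa `^ p'^-1 != 0 by rewrite gt_eqF// powR_gt0.
  by field.
move=> alj.
(* The part of the j-th cube, rescaled from the intervals in [del], where every one-dimensional
   factor of the derivative is bounded away from 0. *)
pose A := obox (fun i => y i + scale rho j * (del i).1.2)
               (fun i => y i + scale rho j * (del i).2) : set 'rV[R]_d.
have mA : lebesgue_rV d A = (kappa * scale rho j ^+ d)%:E.
  rewrite lebesgue_obox; last first.
    by move=> i; rewrite lerD2l ler_wpM2l ?(ltW s0)//; have [_ /ltW] := hdel i.
  congr EFin; under eq_bigr do rewrite opprD addrACA subrr add0r -mulrBr.
  by rewrite big_split/= prodr_const card_ord mulrC.
have Ax x : A x -> [/\ obox y (fun i => y i + rho) x & al < `|comb m p y rho n a beta x|].
  move=> xA.
  have px i : (del i).1.1 <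
      `|derive1n (beta i) (@profile R) ((x ord0 i - y i) / scale rho j)|.
    have [_ _ h] := hdel i; apply: h; have /andP[h1 h2] := xA i.
    rewrite ltr_pdivlMr// ltr_pdivrMr// ltrBrDl ltrBlDl.
    by rewrite ![_ * scale _ _]mulrC h1.
  have PD : Delta <=
      \prod_i `|derive1n (beta i) (@profile R) ((x ord0 i - y i) / scale rho j)|.
    apply: ler_prod => i _; rewrite (ltW (px i)) andbT.
    by have [/ltW] := hdel i.
  have wj : wave y rho j beta x != 0.
    rewrite waveE// mulf_neq0 ?expf_neq0 ?invr_neq0 ?(gt_eqF s0)//.
    by rewrite -normr_gt0 normr_prod (lt_le_trans D0).
  split.
    move=> i; have /andP[h1 h2] := wave_supp rho0 wj i.
    by have := scale_le_rho rho0 j => h3; apply/andP; split; lra.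
  rewrite (combE m p d0 rho0 a wj) waveE// -mulrA [weight _ _ _ _ * _]mulrA.
  rewrite weight_scale// -expo.
  rewrite !normrM (ger0_norm (powR_ge0 _ _)) normr_prod.
  apply: lt_le_trans alj _; rewrite ler_wpM2l// ler_wpM2l ?powR_ge0//.
have [N [mN N0 sN]] := aeg.
rewrite -mA.
have mOg : measurable (Omega `&` [set x | al < `|g x|]).
  rewrite (_ : Omega `&` _ = Omega `&` (Num.norm \o g) @^-1` `]al, +oo[).
    by apply: measurableT_comp => //; exact: measurable_itv.
  by apply/seteqP; split => x [Dx h]; split => //; move: h; rewrite /= in_itv/= andbT.
(* The null set [N], off which [g] agrees with the combination on the box, is added so that all of
   [A] is covered. *)
apply: (@le_trans _ _ (lebesgue_rV d ((Omega `&` [set x | al < `|g x|]) `|` N))).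
  apply: le_measure; rewrite ?inE; [exact: measurable_obox|exact: measurableU|].
  move=> x xA; have [Ox alx] := Ax x xA.
  have [Nx|nNx] := pselect (N x); [by right|left].
  have gx : g x = comb m p y rho n a beta x.
    have : obox y (fun i => y i + rho) x ->
        (EFin \o g) x = (EFin \o comb m p y rho n a beta) x.
      by apply: contrapT => nx; apply: nNx; exact: sN.
    by move=> /(_ Ox) [].
  split; last by rewrite /= gx.
  by apply: yO => i; have /andP[/ltW -> /ltW ->] := Ox i.
apply: le_trans (measureU2 _ _ _) _ => //.
by rewrite [X in (_ + X)%E](_ : _ = 0%E) ?adde0.
Qed.

(** * Sobolev and Lorentz quasi-norms of the combinations *)

Lemma sobolev_comb_upper {R : realType} d m (p : R) (y : 'I_d -> R) rho (q : \bar R) :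
  (0 < d)%N -> 0 < rho -> rho <= 1 -> 0 < p -> (0 < q)%E ->
  exists2 C : R, 0 < C & forall n a (Omega : set 'rV[R]_d), open Omega ->
  (sobolev_lorentz_norm m p q Omega (comb m p y rho n a (fun=> 0%N)) <=
   (C * ellnorm q n a)%:E)%E.
Proof.
move=> d0 rho0 rho1 p0 q0.
have [C C0 hC] := @comb_upper R d m p y rho p q d0 rho0 rho1 p0 q0.
pose S : R := \sum_(alpha : {ffun 'I_d -> 'I_m.+1} | (\sum_i alpha i <= m)%N) C.
have S0 : 0 <= S by apply: sumr_ge0 => *; exact: ltW.
exists (S + 1); first by rewrite ltr_wpDl.
move=> n a Omega oO.
apply: (@le_trans _ _ (S * ellnorm q n a)%:E); last first.
  by rewrite lee_fin ler_wpM2r ?ellnorm_ge0// lerDl.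
rewrite /S mulr_suml -sumEFin; apply: lee_sum => alpha am.
apply: ge_ereal_inf; exists (lorentz_norm (lebesgue_rV d) Omega p q
  (comb m p y rho n a (fun i => alpha i))).
  exists (comb m p y rho n a (fun i => alpha i)) => //.
  exact/weak_derivative_family/comb_family.
apply: hC => //; first exact: open_measurable_rV.
have : (\sum_i alpha i)%N%:R <= m%:R :> R by rewrite ler_nat.
by move: (d%:R / p) => D h; lra.
Qed.

(* It suffices to consider the derivative of order m in the first variable. *)
Lemma sobolev_comb_lower {R : realType} d m (p : R) (y : 'I_d -> R) rho (q : \bar R) :
  (0 < d)%N -> 0 < rho -> 0 < p -> (0 < q)%E ->
  exists2 c : R, 0 < c & forall n a (Omega : set 'rV[R]_d), open Omega ->
    cbox y (fun i => y i + rho) `<=` Omega ->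
  ((c * ellnorm q n a)%:E <=
   sobolev_lorentz_norm m p q Omega (comb m p y rho n a (fun=> 0%N)))%E.
Proof.
move=> d0 rho0 p0 q0; pose i0 := Ordinal d0.
pose alpha0 : {ffun 'I_d -> 'I_m.+1} := [ffun i => if i == i0 then ord_max else ord0].
have sum0 : (\sum_i alpha0 i = m)%N.
  rewrite (bigD1 i0)//= ffunE eqxx big1 ?addn0// => i /negbTE ii0.
  by rewrite ffunE ii0.
have [|c c0 hc] := @comb_lower R d m p y rho p q (fun i => alpha0 i) d0 rho0 p0 q0.
  by rewrite sum0; ring.
exists c => // n a Omega oO yO.
rewrite /sobolev_lorentz_norm (bigD1 alpha0)/=; last by rewrite sum0.
apply: (@le_trans _ _ (ereal_inf [set lorentz_norm (lebesgue_rV d) Omega p q g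
              | g in weak_derivative Omega (fun i => alpha0 i)
                       (comb m p y rho n a (fun=> 0%N))])).
  apply/ereal_infP => _ [g wg <-]; apply: hc => //.
  - exact: open_measurable_rV.
  - by have [_ [mg _] _] := wg.
  apply: (weak_derivative_unique oO yO wg).
  exact/weak_derivative_family/comb_family.
rewrite leeDl//; apply: sume_ge0 => alpha _; apply/ereal_infP => _ [g _ <-].
exact: lorentz_norm_ge0.
Qed.

Lemma ellnorm0 {R : realType} (q : \bar R) : (0 < q)%E -> ellnorm q 0 (fun=> 0 : R) = 0.
Proof.
case: q => [q| |]//= q0; last by rewrite big_ord0.
by rewrite big_ord0 powR0// invr_neq0// gt_eqF// -lte_fin.
Qed.

Lemma comb_space0 {R : realType} d m (p : R) (y : 'I_d -> R) rho (q : \bar R)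
    (Omega : set 'rV[R]_d) n a :
  (0 < d)%N -> 0 < rho -> rho <= 1 -> 0 < p -> (0 < q)%E -> open Omega ->
  cbox y (fun i => y i + rho) `<=` Omega ->
  qn_carrier (sobolev_lorentz_space0 m p q Omega) (comb m p y rho n a (fun=> 0%N)).
Proof.
move=> d0 rho0 rho1 p0 q0 oO yO.
have [C C0 hC] := @sobolev_comb_upper R d m p y rho q d0 rho0 rho1 p0 q0.
split.
  split; last exact: le_lt_trans (hC n a Omega oO) (ltry _).
  exact/continuous_locally_integrable/(comb_family m p y rho n a (fun=> 0%N)).1.
move=> eps eps0; exists (comb m p y rho n a (fun=> 0%N)).
  exact: test_function_comb.
rewrite /= subrr.
(* The approximating test function is the combination itself; that the zero function has norm 0 is
   read off from the upper bound for the empty combination. *)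
have -> : 0 = comb m p y rho 0 (fun=> 0) (fun=> 0%N) :> ('rV[R]_d -> R).
  by apply/funext => x; rewrite /comb big_ord0.
apply: le_lt_trans (hC 0%N _ Omega oO) _.
by rewrite ellnorm0// mulr0 lte_fin.
Qed.

Lemma comb_lorentz {R : realType} d m (p : R) (y : 'I_d -> R) rho (p' : R) (r : \bar R) :
  (0 < d)%N -> 0 < rho -> rho <= 1 -> 0 < p' -> (0 < r)%E ->
  - (d%:R / p') = m%:R - d%:R / p ->
  exists c C : R, [/\ 0 < c, 0 < C & forall n a (Omega : set 'rV[R]_d), open Omega ->
    cbox y (fun i => y i + rho) `<=` Omega ->
    let f := comb m p y rho n a (fun=> 0%N) in
    [/\ qn_carrier (lorentz_space p' r Omega) f,
        ((c * ellnorm r n a)%:E <= lorentz_norm (lebesgue_rV d) Omega p' r f)%E &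
        (lorentz_norm (lebesgue_rV d) Omega p' r f <= (C * ellnorm r n a)%:E)%E]].
Proof.
move=> d0 rho0 rho1 p0 r0 expo.
have sum0 : (\sum_(i < d) 0 = 0)%N by rewrite big1.
have [|c c0 hc] := @comb_lower R d m p y rho p' r (fun=> 0%N) d0 rho0 p0 r0.
  by rewrite sum0 subr0.
have [C C0 hC] := @comb_upper R d m p y rho p' r d0 rho0 rho1 p0 r0.
exists c, C; split => // n a Omega oO yO f.
have mO := open_measurable_rV oO.
have mf : measurable_fun Omega f.
  apply: measurable_funTS; apply: continuous_measurable_rV.
  exact: (comb_family m p y rho n a (fun=> 0%N)).1.
have U : (lorentz_norm (lebesgue_rV d) Omega p' r f <= (C * ellnorm r n a)%:E)%E.
  by apply: hC; rewrite ?sum0// subr0 expo.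
split => //; last by apply: hc => //; exact: ae_eq_refl.
by split => //; exact: le_lt_trans U (ltry _).
Qed.

(** * The span of the dilated bumps, and the theorem *)

Section span.
Context {R : realType} {d : nat} (m : nat) (p : R) (y : 'I_d -> R) (rho : R).

(** The basis vector is written as a combination with one nonzero coefficient, so that its
    membership in the spaces is an instance of [comb_space0]. *)
Definition bubble (j : nat) : 'rV[R]_d -> R :=
  comb m p y rho j.+1 (fun k => (k == j)%:R) (fun=> 0%N).

Lemma bubbleE j x : bubble j x = @weight R d m p rho j * wave y rho j (fun=> 0%N) x.
Proof.
rewrite /bubble /comb (bigD1 ord_max)//= eqxx mul1r big1 ?addr0// => k kj.
by rewrite (_ : (k == j :> nat) = false) ?mul0r//; exact/negbTE.
Qed.

Lemma lincomb_bubble n (a : 'I_n -> R) (b : nat -> R) : (forall i : 'I_n, b i = a i) ->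
  lincomb (fun j : 'I_n => bubble j) a = comb m p y rho n b (fun=> 0%N).
Proof.
move=> ab; apply/funext => x; rewrite /lincomb fct_sumE /comb.
by apply: eq_bigr => j _; rewrite ab -mulrA -bubbleE.
Qed.

End span.

Lemma ext_ord {R : realType} n (a : 'I_n -> R) :
  exists b : nat -> R, forall i : 'I_n, b i = a i.
Proof. by exists (fun k => oapp a 0 (insub k)) => i; rewrite valK. Qed.

Lemma ellnorm_eq0 {R : realType} q n (a : nat -> R) : (0 < q)%E -> ellnorm q n a = 0 ->
  forall i : 'I_n, a i = 0.
Proof.
move=> q0 a0 i; apply/eqP; rewrite -normr_le0; case: q q0 a0 => [q| |]// q0; last first.
  by move=> <-; exact: le_ellnormy.
move=> /powR_eq0_eq0 /eqP; rewrite psumr_eq0; last by move=> j _; exact: powR_ge0.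
by move=> /allP /(_ i (mem_index_enum _))/= /eqP /powR_eq0_eq0 ->.
Qed.

Lemma comb_pad {R : realType} d m (p : R) (y : 'I_d -> R) rho n N a beta :
  (n <= N)%N ->
  comb m p y rho n a beta =
  comb m p y rho N (fun k => if (k < n)%N then a k else 0) beta.
Proof.
move=> nN; apply/funext => x; rewrite /comb.
rewrite (big_ord_widen N (fun j => (a j * @weight R d m p rho j) * wave y rho j beta x) nN).
rewrite big_mkcond; apply: eq_bigr => j _.
by case: ifP => // _; rewrite !mul0r.
Qed.

Lemma comb_linear {R : realType} d m (p : R) (y : 'I_d -> R) rho n k a b (c : R) beta :
  exists N a', c *: comb m p y rho n a beta + comb m p y rho k b beta =
    comb m p y rho N a' beta.
Proof.
rewrite (comb_pad m p y rho a beta (leq_maxl n k)).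
rewrite (comb_pad m p y rho b beta (leq_maxr n k)).
exists (maxn n k), (fun j => c * (if (j < n)%N then a j else 0) +
  (if (j < k)%N then b j else 0)); apply/funext => x.
rewrite /comb !fctE /GRing.scale/= mulr_sumr -big_split/=.
by apply: eq_bigr => j _; rewrite !mulrDl !mulrA.
Qed.

Lemma open_cbox {R : realType} d (Omega : set 'rV[R]_d) : open Omega ->
  Omega !=set0 -> exists (y : 'I_d -> R) rho,
    [/\ 0 < rho, rho <= 1 & cbox y (fun i => y i + rho) `<=` Omega].
Proof.
move=> oO [x Ox]; have : nbhs x Omega by exact: open_nbhs_nbhs.
move=> /nbhs_ballP[e /= e0 xe].
(* Half the radius keeps the closed cube inside the open ball; the cap at 1 provides [rho <= 1],
   which makes all scales at most 1. *)
exists (fun i => x ord0 i), (Num.min (e / 2) 1); split.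
- by rewrite lt_min ltr01 divr_gt0.
- by rewrite ge_min lexx orbT.
move=> z zx; apply: xe; split => // i j; rewrite ord1 /ball/=.
have /andP[h1 h2] := zx j.
have h3 : Num.min (e / 2) 1 <= e / 2 by rewrite ge_min lexx.
rewrite ltr_norml; apply/andP; split.
  have : z ord0 j <= x ord0 j + e / 2 by rewrite (le_trans h2)// lerD2l.
  by move: e0 => /= ? ?; rewrite -[0]/(ord0); lra.
by move: e0 h1 => /= ? ?; rewrite -[0]/(ord0); lra.
Qed.

Theorem proposition5 (R : realType) (d m : nat) (p : R) (q r : \bar R)
    (Omega : set 'rV[R]_d) :
  (1 <= d)%N -> (1 <= m)%N ->
  1 <= p -> p < d%:R / m%:R ->
  (0 < q)%E -> (q <= r)%E -> (p = 1 -> (q <= 1)%E) ->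
  open Omega -> Omega !=set0 ->
  let pstar : R := d%:R * p / (d%:R - m%:R * p) in
  let W0 := sobolev_lorentz_space0 m p q Omega in
  let L := lorentz_space pstar r Omega in
  (exists2 c : R, 0 < c & forall n : nat, (1 <= n)%N ->
     ((c * n%:R `^ (fine r^-1 - fine q^-1))%:E <= bernstein_number W0 L idfun n)%E)
  /\ (q = r -> ~ strictly_singular W0 L idfun).
Proof.
move=> d0 m0 p1 pdm q0 qr _ oO /(open_cbox oO)[y [rho [rho0 rho1 yO]]] pstar W0 L.
have p0 : 0 < p by exact: lt_le_trans p1.
have dmp : 0 < d%:R - m%:R * p.
  by move: pdm; rewrite ltr_pdivlMr ?ltr0n// subr_gt0 mulrC.
have D0 : 0 < d%:R :> R by rewrite ltr0n.
have ps0 : 0 < pstar by rewrite divr_gt0// mulr_gt0.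
have r0 : (0 < r)%E by exact: lt_le_trans qr.
(* The Sobolev exponent is the one for which the undifferentiated bumps have critical height
   scale^(- d/pstar). *)
have expo : - (d%:R / pstar) = m%:R - d%:R / p.
  by rewrite /pstar; field; rewrite !gt_eqF.
have [C1 C10 hC1] := @sobolev_comb_upper R d m p y rho q d0 rho0 rho1 p0 q0.
have [c1 c10 hc1] := @sobolev_comb_lower R d m p y rho q d0 rho0 p0 q0.
have [c2 [C2 [c20 C20 hL]]] := @comb_lorentz R d m p y rho pstar r d0 rho0 rho1 ps0 r0 expo.
have W0c n a : qn_carrier W0 (comb m p y rho n a (fun=> 0%N)) by exact: comb_space0.
(* Independence is understood modulo vectors of quasi-norm 0, so it is the lower Sobolev bound that
   yields it: the l^q quasi-norm of the coefficients must vanish. *)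
have indep n : independent W0 (fun j : 'I_n => bubble m p y rho j).
  move=> a; have [b ab] := ext_ord a; rewrite (lincomb_bubble _ _ _ _ ab) => a0 i.
  rewrite -ab; apply: (ellnorm_eq0 q0).
  apply/eqP; rewrite eq_le ellnorm_ge0 andbT -(pmulr_rle0 _ c10) -lee_fin.
  by have := hc1 n b Omega oO yO; rewrite [X in (_ <= X)%E]a0.
split.
  (* On the unit sphere of the span, 1 <= C1 |a|_q <= C1 n^(1/q - 1/r) |a|_r, while the target norm
     is at least c2 |a|_r. *)
  exists (c2 / C1); first by rewrite divr_gt0.
  move=> n n0; apply: (@le_trans _ _ (ereal_inf [set qnorm L (idfun x) |
      x in unit_sphere W0 (range (lincomb (fun j : 'I_n => bubble m p y rho j)))])).
    apply/ereal_infP => _ [_ [[a _ <-]] + <-].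
    have [b ab] := ext_ord a; rewrite (lincomb_bubble _ _ _ _ ab) => W1.
    have [_ low _] := hL n b Omega oO yO; apply: le_trans low.
    have : (1 <= C1 * ellnorm q n b)%R.
      by rewrite -lee_fin -W1; exact: hC1.
    have := ellnorm_le b q0 qr n0.
    set A := ellnorm q n b; set B := ellnorm r n b.
    set e := fine q^-1 - fine r^-1 => AB A1.
    have -> : fine r^-1 - fine q^-1 = - e by rewrite opprB.
    have P0 : 0 < n%:R `^ e by rewrite powR_gt0// ltr0n.
    rewrite powRN lee_fin !ler_pdivrMr// -[leLHS]mulr1 -!mulrA ler_pM2l//.
    apply: (le_trans A1); rewrite [leRHS]mulrA [leRHS]mulrC ler_pM2l//.
    by rewrite [leRHS]mulrC.
  apply: ereal_sup_ubound.
  exists (range (lincomb (fun j : 'I_n => bubble m p y rho j))) => //.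
  split.
    by exists (fun j : 'I_n => bubble m p y rho j); split => // i; exact: W0c.
  move=> _ [_ [a _ <-] <-]; have [b ab] := ext_ord a.
  by rewrite (lincomb_bubble _ _ _ _ ab); have [] := hL n b Omega oO yO.
move=> qr'; subst r; apply.
exists [set f | exists n a, f = comb m p y rho n a (fun=> 0%N)]; split.
  split.
  - by move=> _ [n [a ->]]; exact: W0c.
  - by exists 0%N, (fun=> 0); apply/funext => x; rewrite /comb big_ord0.
  - move=> c _ _ [n [a ->]] [k [b ->]].
    have [N [a' ->]] := comb_linear m p y rho n k a b c (fun=> 0%N).
    by exists N, a'.
  - move=> n; exists (fun j : 'I_n => bubble m p y rho j); split; last exact: indep.
    by move=> i; eexists; eexists; reflexivity.
split.
  by move=> _ [_ [n [a ->]] <-]; have [] := hL n a Omega oO yO.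
(* With [q = r] both quasi-norms are compared with the same l^q quasi-norm of the coefficients, and
   the constants are the quotients of the comparison constants. *)
exists (c2 / C1), (C2 / c1); split; [exact: divr_gt0|exact: divr_gt0|].
move=> _ [n [a ->]]; have [_ low up] := hL n a Omega oO yO.
apply/andP; split.
  apply: le_trans low; apply: (@le_trans _ _ ((c2 / C1)%:E * (C1 * ellnorm q n a)%:E)%E).
    by apply: lee_wpmul2l; [rewrite lee_fin divr_ge0// ltW|exact: hC1].
  by rewrite -EFinM lee_fin mulrA divfK ?gt_eqF.
apply: (le_trans up).
apply: (@le_trans _ _ ((C2 / c1)%:E * (c1 * ellnorm q n a)%:E)%E).
  by rewrite -EFinM lee_fin mulrA divfK ?gt_eqF.
by apply: lee_wpmul2l; [rewrite lee_fin divr_ge0// ltW|exact: hc1].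
Qed.
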